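(* Let $M$ be a flat semiumbilical surface in $\mathbb R^4$ with first and second fundamental forms $g$ and $\alpha$. Let $c$ be the section of $NM$ with $c\cdot\alpha=g$, let $j=\frac12\operatorname{grad}(c\cdot c)\in\mathfrak X(M)$, let $e\in\mathfrak X(M)$ satisfy $\nabla^\top_Xe=X$ for all $X\in\mathfrak X(M)$, and let $k\in\Gamma NM$ satisfy $(D_X(e-k))^\bot=0$ for all $X\in\mathfrak X(M)$. Let $t_1,t_2\in\mathbb R$ and for $i=1,2$ let $F_i:M\to\mathbb R^4$, $F_i(p)=p+t_ic_p-(1-t_i)e_p$; assume that each $F_i$ is a diffeomorphism onto its image $F_i(M)$ (a flat semiumbilical surface). Let $\tilde c_i$ be the normal section of $F_i(M)$ whose inner product with the second fundamental form of $F_i(M)$ is the first fundamental form of $F_i(M)$, and let $\tilde e_i$ be a tangent vector field on $F_i(M)$ with $\nabla^\top_u\tilde e_i=u$ for all tangent $u$. Let $f_2\circ f_1:M\to\mathbb R^4$ denote $F_1$ followed by the map $q\mapsto q+t_2\tilde c_1(q)-(1-t_2)\tilde e_1(q)$ on $F_1(M)$, and let $f_1\circ f_2:M\to\mathbb R^4$ denote $F_2$ followed by the map $q\mapsto q+t_1\tilde c_2(q)-(1-t_1)\tilde e_2(q)$ on $F_2(M)$. Then, modulo the addition of a parallel section of $NM$, $$(f_2\circ f_1)(p)=p+t_1t_2(c_p-j_p)-(1-t_1)(1-t_2)(e_p-k_p)=(f_1\circ f_2)(p),\qquad p\in M,$$ where the first equality is exact for the choice $\tilde e_1=(t_1c-(1-t_1)k)\circ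 F_1^{-1}$.
   Context: $M$ is a smooth 2-dimensional surface immersed in $\mathbb R^4$; since everything is local it may be regarded as embedded. $T_pM$ and $N_pM=(T_pM)^\bot$ are regarded as vector subspaces of $\mathbb R^4$; $\cdot$ is the standard inner product; $\mathfrak X(M)$ is the space of smooth tangent vector fields, $\Gamma NM$ the space of smooth normal sections; both are regarded as $\mathbb R^4$-valued maps. $D$ is the ordinary directional derivative; $\nabla^\top_XY=(D_XY)^\top$, $\alpha(X,Y)=(D_XY)^\bot$ and $\nabla^\bot_Xu=(D_Xu)^\bot$ for $u\in\Gamma NM$ ($u$ is parallel if $\nabla^\bot u=0$); the same notation is used on every surface. $\operatorname{grad}$ is the gradient with respect to $g$. A surface is flat if the curvature of $\nabla^\top$ is zero everywhere. The curvature ellipse at $p$ is $\{\alpha_p(t,t)/(t\cdot t): t\in T_pM\setminus\{0\}\}\subset N_pM$. A point $p$ is semiumbilic if its curvature ellipse lies in an affine line (a segment or a point), and a point of inflection if it lies in an affine line through the origin of $N_pM$ (umbilic points, where the ellipse is a single point, count as inflection points). A surface is called semiumbilical if all its points are semiumbilic and none is a point of inflection; i.e. at each point the curvature ellipse is a nondegenerate segment not collinear with the origin. On a semiumbilical surface in $\mathbb R^4$ the normal section whose inner product with the second fundamental form equals the first fundamental form exists and is unique; $c\cdot\alpha=g$ means $c\cdot\alpha(X,Y)=X\cdot Y$ for all tangent $X,Y$. *)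

(* Defs.v *)
From HB Require Import structures.
From mathcomp Require Import all_boot all_order all_algebra.
From mathcomp Require Import all_classical all_reals all_analysis.
Set Implicit Arguments.
Unset Strict Implicit.
Unset Printing Implicit Defensive.
Import Order.TTheory GRing.Theory Num.Theory.
Import numFieldNormedType.Exports.
Local Open Scope classical_set_scope.
Local Open Scope ring_scope.

Section Smoothness.
Variables (R : realType) (m : nat) (V : normedModType R).

(* For open W, this is the usual class C^k: f is C^k.+1 on W iff it is
   differentiable on W and all its directional derivatives are C^k on W. *)
Fixpoint Ck (k : nat) (W : set 'rV[R]_m.+1) (f : 'rV[R]_m.+1 -> V) : Prop :=
  if k is l.+1 then
    (forall x, W x -> differentiable f x) /\ (forall v, Ck l W ('D_v f))
  else forall x, W x -> {for x, continuous f}.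

Definition smooth_on (W : set 'rV[R]_m.+1) (f : 'rV[R]_m.+1 -> V) : Prop :=
  forall k, Ck k W f.

(* Maps defined on a subset M of R^m.+1 are represented by total functions
   whose values outside M are irrelevant. *)
Definition smooth_extension (M : set 'rV[R]_m.+1) (f : 'rV[R]_m.+1 -> V)
    (p : 'rV[R]_m.+1) (g : 'rV[R]_m.+1 -> V) : Prop :=
  exists W, [/\ open W, W p, smooth_on W g & forall q, W q -> M q -> g q = f q].

Definition smooth (M : set 'rV[R]_m.+1) (f : 'rV[R]_m.+1 -> V) : Prop :=
  forall p, M p -> exists g, smooth_extension M f p g.

(* D_v f at p: the derivative at p along v of a smooth local extension of f.
   When v is tangent to M it does not depend on the extension. *)
Definition Dd (M : set 'rV[R]_m.+1) (f : 'rV[R]_m.+1 -> V)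
    (p v : 'rV[R]_m.+1) : V :=
  'D_v (xget f [set g | smooth_extension M f p g]) p.

End Smoothness.

Section Surfaces.
Variable R : realType.
Local Notation E4 := 'rV[R]_4.
Local Notation E2 := 'rV[R]_2.
Implicit Types (M N : set E4) (X Y Z : E4 -> E4).

Definition dot (u v : E4) : R := (u *m v^T) 0 0.

(* Embedded surface: locally M is diffeomorphic, by x with inverse y, to an
   open subset U of R^2, smoothness of y being that of maps on subsets of R^4.
   Differentiating y \o x = id shows that x is an immersion. *)
Definition is_surface M : Prop :=
  forall p, M p -> exists (W : set E4) (U : set E2) (x : E2 -> E4) (y : E4 -> E2),
    [/\ open W, W p & open U] /\
    [/\ smooth_on U x,
        smooth (M `&` W) y,
        forall a, U a -> (M `&` W) (x a) /\ y (x a) = a &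
        forall q, (M `&` W) q -> U (y q) /\ x (y q) = q].

Definition diffeomorphism M N (F G : E4 -> E4) : Prop :=
  [/\ smooth M F,
      smooth N G,
      forall p, M p -> N (F p) /\ G (F p) = p &
      forall q, N q -> M (G q) /\ F (G q) = q].

(* T_pM: the velocities at p of the curves in M through p. *)
Definition tangent M (p v : E4) : Prop :=
  exists gamma : R -> E4,
    [/\ gamma 0 = p, \forall s \near 0, M (gamma s) & is_derive (0 : R) (1 : R) gamma v].

Definition normal M (p u : E4) : Prop :=
  forall v, tangent M p v -> dot u v = 0.

Definition tanpart M (p w : E4) : E4 :=
  xget 0 [set v | tangent M p v /\ normal M p (w - v)].

Definition norpart M (p w : E4) : E4 := w - tanpart M p w.

Definition tangent_field M X : Prop :=
  smooth M X /\ forall p, M p -> tangent M p (X p).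

Definition normal_section M (u : E4 -> E4) : Prop :=
  smooth M u /\ forall p, M p -> normal M p (u p).

Definition nablaT M X Y : E4 -> E4 := fun p => tanpart M p (Dd M Y p (X p)).

Definition alpha M X Y : E4 -> E4 := fun p => norpart M p (Dd M Y p (X p)).

Definition nablaN M X (u : E4 -> E4) : E4 -> E4 :=
  fun p => norpart M p (Dd M u p (X p)).

Definition parallel_section M (u : E4 -> E4) : Prop :=
  normal_section M u /\
  forall X, tangent_field M X -> forall p, M p -> nablaN M X u p = 0.

Definition grad M (f : E4 -> R) : E4 -> E4 := fun p =>
  xget 0 [set v | tangent M p v /\
                  forall w, tangent M p w -> dot v w = Dd M f p w].

Definition bracket M X Y : E4 -> E4 :=
  fun p => Dd M Y p (X p) - Dd M X p (Y p).

Definition curvature M X Y Z : E4 -> E4 := fun p =>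
  nablaT M X (nablaT M Y Z) p - nablaT M Y (nablaT M X Z) p
  - nablaT M (bracket M X Y) Z p.

Definition flat M : Prop :=
  forall X Y Z, tangent_field M X -> tangent_field M Y -> tangent_field M Z ->
  forall p, M p -> curvature M X Y Z p = 0.

(* alpha_p(t,t)/(t.t), where t runs over the nonzero values at p of the tangent
   fields: every tangent vector at p is such a value, and alpha is tensorial. *)
Definition curvature_ellipse M (p : E4) : set E4 :=
  [set n | exists T, [/\ tangent_field M T, T p != 0 &
                         n = (dot (T p) (T p))^-1 *: alpha M T T p]].

Definition semiumbilic_point M (p : E4) : Prop :=
  exists a d, [/\ normal M p a, normal M p d, d != 0 &
    curvature_ellipse M p `<=` [set a + s *: d | s in [set: R]]].

Definition inflection_point M (p : E4) : Prop :=
  exists d, [/\ normal M p d, d != 0 &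
    curvature_ellipse M p `<=` [set s *: d | s in [set: R]]].

Definition semiumbilical M : Prop :=
  forall p, M p -> semiumbilic_point M p /\ ~ inflection_point M p.

Definition flat_semiumbilical_surface M : Prop :=
  [/\ is_surface M, flat M & semiumbilical M].

Definition metric_section M (c : E4 -> E4) : Prop :=
  normal_section M c /\
  forall X Y, tangent_field M X -> tangent_field M Y ->
  forall p, M p -> dot (c p) (alpha M X Y p) = dot (X p) (Y p).

Definition radial_field M (e : E4 -> E4) : Prop :=
  tangent_field M e /\
  forall X, tangent_field M X -> forall p, M p -> nablaT M X e p = X p.

Definition transf (t : R) (c e : E4 -> E4) : E4 -> E4 :=
  fun p => p + t *: c p - (1 - t) *: e p.

End Surfaces.

(* Main.v *)
(* Write II for the second fundamental form of M and n(X) for the normal part of D_X c.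
   Since c.II = g and e is radial, D_X c = - X + n(X) and D_X e = X + II(X, e), so that
   D_X F = t n(X) - (1 - t) II(X, e) is normal to M: the tangent plane of F(M) at F(p)
   is the normal plane of M at p, and conversely.  As II(X, e) is the normal part of
   D_X k, the normal part of D_X (t c - (1 - t) k) is D_X F, which says that
   (t c - (1 - t) k) o F^-1 is a radial field on F(M).  The metric section of F(M) is
   ((1 - t) e - t j) o F^-1; this amounts to II(X, j) = n(X), a consequence of the
   symmetry of the second derivatives of c and of the Gauss equation of the flat
   surface M.  The formula for the composition follows by substitution and is symmetric
   in t1 and t2; another choice of the radial field on F(M) changes it by a section of
   NM with zero normal covariant derivative.  By the Gauss equation F(M) is flat because
   the shape operators of M commute: the one of c is the identity and NM has rank 2. *)

Require Import Defs.
From HB Require Import structures.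
From mathcomp Require Import all_boot all_order all_algebra.
From mathcomp Require Import all_classical all_reals all_analysis.
From mathcomp Require Import ring lra.
Set Implicit Arguments.
Unset Strict Implicit.
Unset Printing Implicit Defensive.
Import Order.TTheory GRing.Theory Num.Theory.
Import numFieldNormedType.Exports.
Local Open Scope classical_set_scope.
Local Open Scope ring_scope.

(** * Calculus of C^k maps *)

Section Calculus.
Variable R : realType.

(** The exchange of tangent and normal planes has one quantitative form on which the later steps
    rest. Tangent fields of [F(M)], transported to [M], are normal sections of [M]; hence for [w]
    normal to [M] the second fundamental form of [F(M)] at [dF u] and [w] is [- A_w u], with [A_w]
    the shape operator of [M]. This identifies the metric section of [F(M)], reduces flatness to
    commuting shape operators and, since [A_c] is the identity, excludes inflection points: the
    values [- u] fill a plane, while an inflection point would confine them to a line. For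
    [II(X, j) = n(X)], the defect [n(X) - II(X, j)] is orthogonal to [c] by the definition of [j],
    so it lies along one normal direction [d]. If it were nonzero, its symmetry would give a nonzero
    tangent vector killed by the shape operator of [d], which flatness forbids. Maps on [M] are
    total functions differentiated through a chosen extension. Fields and forms are therefore first
    reduced to pointwise bilinear maps on planes, after which the geometric core is linear
    algebra. *)

Lemma near_eq_differentiable (V W : normedModType R) (f g : V -> W) (x : V) :
  (\forall y \near x, f y = g y) -> differentiable f x -> differentiable g x.
Proof.
move=> fg df.
have -> : g = f + (g - f) by apply/funext => y /=; rewrite addrC subrK.
apply: (differentiableD df).
(* [h] vanishes near [x], so the zero map serves as its differential there. *)
set h := g - f.
have h0 : h \o shift x = cst (h x) + (\0 : V -> W) +o_ 0 id.
  apply/eqaddoP => _/posnumP[e].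
  have fg0 : \forall y \near 0, f (y + x) = g (y + x).
    by have := fg; rewrite (near_shift 0) /=; apply: filterS => y; rewrite subr0.
  near=> y.
  rewrite /h /= !fctE /= !opprD /=.
  rewrite (_ : g (y + x) = f (y + x)); last by symmetry; near: y.
  by rewrite (nbhs_singleton fg) subr0 subrr add0r opprK addrC subrr normr0 mulr_ge0.
have zc : continuous (\0 : {linear V -> W}) by move=> ?; exact: cvg_cst.
by apply/diff_locallyP; rewrite (diff_unique zc h0).
Unshelve. all: by end_near. Qed.

Lemma derive_comp (U V W : normedModType R) (f : V -> W) (g : U -> V) x v :
  differentiable g x -> differentiable f (g x) ->
  'D_v (f \o g) x = 'D_('D_v g x) f (g x).
Proof.
move=> dg df; rewrite !deriveE//; last exact: differentiable_comp.
by rewrite diff_comp.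
Qed.

Lemma derive_lin (V W : normedModType R) (L : {linear V -> W}) x v :
  continuous L -> 'D_v L x = L v.
Proof.
by move=> Lc; rewrite deriveE ?diff_lin//; exact: linear_differentiable.
Qed.

Lemma derive_basis (m : nat) (W : normedModType R) (f : 'rV[R]_m.+1 -> W) x v :
  differentiable f x ->
  'D_v f x = \sum_i v 0 i *: 'D_(delta_mx 0 i) f x.
Proof.
move=> df; rewrite deriveE// {1}(row_sum_delta v) linear_sum.
by apply: eq_bigr => i _; rewrite linearZ /= deriveE.
Qed.


(** Named so that it can carry the linear structure that [Ck_lin] and [derive_lin] expect. *)
Definition line (V : normedModType R) (v : V) (r : R) : V := r *: v.

Fact line_linear (V : normedModType R) (v : V) : linear (line v).
Proof. by move=> a x y; rewrite /line scalerDl scalerA. Qed.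

HB.instance Definition _ (V : normedModType R) (v : V) :=
  GRing.isLinear.Build R R V _ (line v) (line_linear v).

Lemma line_continuous (V : normedModType R) (v : V) : continuous (line v).
Proof. exact: scalel_continuous. Qed.

Definition row_coord (m : nat) (i : 'I_m.+1) (u : 'rV[R]_m.+1) : R := u 0 i.

Fact row_coord_linear m i : linear (@row_coord m i : 'rV[R]_m.+1 -> R^o).
Proof. by move=> a x y; rewrite /row_coord !mxE. Qed.

HB.instance Definition _ m i :=
  GRing.isLinear.Build R 'rV[R]_m.+1 R^o _ (@row_coord m i) (row_coord_linear i).

Section CkTheory.
Variable m : nat.
Local Notation E := 'rV[R]_m.+1.
Implicit Types (V : normedModType R) (W : set E).

Lemma Ck_mono V k W (f : E -> V) : Ck k.+1 W f -> Ck k W f.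
Proof.
elim: k f => [|k IH] f [df Df].
  by move=> x Wx; apply: differentiable_continuous; exact: df.
by split=> // v; apply: IH; exact: Df.
Qed.

Lemma Ck_subset V k W W' (f : E -> V) : W' `<=` W -> Ck k W f -> Ck k W' f.
Proof.
move=> WW'; elim: k f => [|k IH] f.
  by move=> cf x W'x; apply/cf/WW'.
by move=> [df Df]; split=> [x /WW'|v]; [exact: df|exact/IH/Df].
Qed.

Lemma Ck_eq V k W (f g : E -> V) : open W ->
  (forall x, W x -> f x = g x) -> Ck k W f -> Ck k W g.
Proof.
move=> oW.
have nW x (P : E -> Prop) : W x -> (forall x, W x -> P x) -> \forall y \near x, P y.
  by move=> Wx WP; apply: filterS WP _; exact: open_nbhs_nbhs.
elim: k f g => [|k IH] f g fg.
  move=> cf x Wx; rewrite /prop_for /continuous_at -fg//.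
  have fgx : \forall y \near x, f y = g y by exact: nW.
  exact: cvg_trans (near_eq_cvg fgx) (cf x Wx).
move=> [df Df]; split=> [x Wx|v].
  by apply: near_eq_differentiable (df x Wx); exact: (nW x (fun y => f y = g y)).
by apply: IH (Df v) => x Wx; apply: near_eq_derive; exact: (nW x (fun y => f y = g y)).
Qed.

Lemma Ck_local V k W (f : E -> V) :
  (forall x, W x -> exists W', [/\ open W', W' x & Ck k W' f]) -> Ck k W f.
Proof.
elim: k f => [|k IH] f loc.
  by move=> x /loc [W' [_ W'x]]; exact.
split=> [x /loc [W' [_ W'x []]]|v]; first by move=> + _; exact.
by apply: IH => x /loc [W' [oW' W'x [_ D]]]; exists W'; split=> //; exact: D.
Qed.

Lemma Ck_cst V k W (a : V) : Ck k W (cst a).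
Proof.
elim: k a => [|k IH] a; first by move=> x _; exact: cst_continuous.
split=> [x _|v]; first exact: differentiable_cst.
by rewrite (_ : 'D_v (cst a) = cst 0)//; apply/funext => x; rewrite derive_cst.
Qed.

Lemma CkD V k W (f g : E -> V) : open W ->
  Ck k W f -> Ck k W g -> Ck k W (f + g).
Proof.
move=> oW; elim: k f g => [|k IH] f g.
  by move=> cf cg x Wx; exact: (continuousD (cf _ Wx) (cg _ Wx)).
move=> [df Df] [dg Dg]; split=> [x Wx|v].
  exact: (differentiableD (df _ Wx) (dg _ Wx)).
apply: (Ck_eq oW) (IH _ _ (Df v) (Dg v)) => x Wx.
by rewrite deriveD//; apply: diff_derivable; [exact: df|exact: dg].
Qed.

Lemma Ck_lin V V' (L : {linear V -> V'}) k W (f : E -> V) : continuous L ->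
  open W -> Ck k W f -> Ck k W (L \o f).
Proof.
move=> Lc oW; elim: k f => [|k IH] f.
  by move=> cf x Wx; exact: (continuous_comp (cf _ Wx) (Lc _)).
move=> [df Df].
have dL y : differentiable L y by exact: linear_differentiable.
split=> [x Wx|v].
  by apply: (differentiable_comp (df _ Wx)); exact: dL.
apply: (Ck_eq oW) (IH _ (Df v)) => x Wx /=.
by rewrite (derive_comp _ (df _ Wx) (dL _)) derive_lin.
Qed.

Lemma row_coord_continuous n i : continuous (@row_coord n i).
Proof. exact: coord_continuous. Qed.

Lemma Ck_coord n k W (f : E -> 'rV[R]_n.+1) (i : 'I_n.+1) : open W ->
  Ck k W f -> Ck k W (fun x => f x 0 i : R).
Proof.
exact: (@Ck_lin _ _ (@row_coord n i) k W f (@row_coord_continuous n i)).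
Qed.

Lemma Ck_sum V n k W (f : 'I_n -> E -> V) : open W ->
  (forall i, Ck k W (f i)) -> Ck k W (\sum_i f i).
Proof.
move=> oW cf; elim/big_ind: _ => //; first exact: Ck_cst.
by move=> g h; exact: CkD.
Qed.

(** A row is the sum of its coordinates times basis vectors, so products and compositions need only
    be treated for scalar functions. *)
Lemma Ck_row n k W (f : E -> 'rV[R]_n.+1) : open W ->
  (forall i, Ck k W (fun x => f x 0 i : R)) -> Ck k W f.
Proof.
move=> oW cf.
rewrite (_ : f = \sum_i (line (delta_mx 0 i) \o (fun x => f x 0 i))).
  by apply: Ck_sum => // i; apply: Ck_lin => //; exact: line_continuous.
by apply/funext => x; rewrite fct_sumE {1}[f x]row_sum_delta.
Qed.

Lemma CkM k W (f g : E -> R) : open W ->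
  Ck k W f -> Ck k W g -> Ck k W (fun x => f x * g x).
Proof.
move=> oW; elim: k f g => [|k IH] f g.
  by move=> cf cg x Wx; exact: (continuousM (cf _ Wx) (cg _ Wx)).
move=> cf cg; have [df Df] := cf; have [dg Dg] := cg; split=> [x Wx|v].
  exact: (differentiableM (df _ Wx) (dg _ Wx)).
apply: (Ck_eq oW) (CkD oW (IH _ _ (Ck_mono cf) (Dg v))
  (IH _ _ (Ck_mono cg) (Df v))) => x Wx.
by rewrite -[RHS]/('D_v (f * g) x) deriveM//; apply: diff_derivable; [exact: df|exact: dg].
Qed.

(** The derivative of [1/f] is [-(1/f)^2 f']; it involves [1/f] again, but one order lower, where
    the induction hypothesis applies. *)
Lemma CkV k W (f : E -> R) : open W -> (forall x, W x -> f x != 0) ->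
  Ck k W f -> Ck k W (fun x => (f x)^-1).
Proof.
move=> oW f0; elim: k => [|k IH].
  by move=> cf x Wx; exact: (continuousV (f0 _ Wx) (cf _ Wx)).
move=> cf; have [df Df] := cf; split=> [x Wx|v].
  by apply: differentiableV; [exact: df|exact: f0].
have cV := IH (Ck_mono cf).
apply: (Ck_eq oW) (CkM oW (CkM oW (@Ck_cst R^o k W (-1)) (CkM oW cV cV)) (Df v)) => x Wx.
rewrite -[RHS]/('D_v (GRing.inv \o f) x) deriveV//; [|exact: f0|exact/diff_derivable/df].
by rewrite /cst mulN1r -invfM -expr2.
Qed.

End CkTheory.

Lemma Ck_comp (m n : nat) (k : nat) (U : set 'rV[R]_m.+1) (W : set 'rV[R]_n.+1)
    (g : 'rV[R]_m.+1 -> 'rV[R]_n.+1) (f : 'rV[R]_n.+1 -> R) :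
  open U -> open W -> (forall x, U x -> W (g x)) ->
  Ck k U g -> Ck k W f -> Ck k U (f \o g).
Proof.
move=> oU oW UW; elim: k f => [|k IH] f.
  by move=> cg cf x Ux; exact: (continuous_comp (cg _ Ux) (cf _ (UW _ Ux))).
move=> cg cf; have [dg Dg] := cg; have [df Df] := cf; split=> [x Ux|v].
  by apply: (differentiable_comp (dg _ Ux)); exact/df/UW.
(* The chain rule gives a derivative of [f] in the moving direction ['D_v g x]. Expanding it in
   partial derivatives leaves fixed directions, to which the induction hypothesis applies. *)
apply: (@Ck_eq _ _ k U (\sum_i (fun x => 'D_v g x 0 i *
   ('D_(delta_mx 0 i) f \o g) x))) => // [x Ux|].
  rewrite (derive_comp _ (dg _ Ux) (df _ (UW _ Ux))).
  by rewrite derive_basis ?fct_sumE//; exact/df/UW.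
apply: Ck_sum => // i; apply: CkM => //; first exact/Ck_coord/Dg.
by apply: IH; [exact: Ck_mono|exact: Df].
Qed.

Lemma Ck_comp_row (m n l : nat) (k : nat) (U : set 'rV[R]_m.+1) (W : set 'rV[R]_n.+1)
    (g : 'rV[R]_m.+1 -> 'rV[R]_n.+1) (f : 'rV[R]_n.+1 -> 'rV[R]_l.+1) :
  open U -> open W -> (forall x, U x -> W (g x)) ->
  Ck k U g -> Ck k W f -> Ck k U (f \o g).
Proof.
move=> oU oW UW cg cf; apply: Ck_row => // i.
exact: (Ck_comp oU oW UW cg (Ck_coord i oW cf)).
Qed.

(** * Symmetry of second derivatives *)

Section Schwarz.
Variables (m : nat).
Local Notation E := 'rV[R]_m.+1.
Implicit Types (W : set E).

Definition second_difference (f : E -> R) (p v w : E) (t : R) : R :=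
  (f (p + t *: v + t *: w) - f (p + t *: v)) - (f (p + t *: w) - f p).

Lemma second_differenceC f p v w t :
  second_difference f p v w t = second_difference f p w v t.
Proof.
by rewrite /second_difference (addrAC p); ring.
Qed.

Lemma is_derive_line (V : normedModType R) (f : E -> V) (q v : E) (s : R) :
  differentiable f (q + s *: v) ->
  is_derive s 1 (fun s : R => f (q + s *: v)) ('D_v f (q + s *: v)).
Proof.
move=> df.
have ds : differentiable (line v) s.
  by apply: linear_differentiable; exact: line_continuous.
have dc : differentiable (cst q : R -> E) s by exact: differentiable_cst.
have dl : differentiable (cst q + line v) s by exact: differentiableD.
have Dl : 'D_1 (cst q + line v) s = v.
  rewrite (deriveD (diff_derivable dc) (diff_derivable ds)) derive_cst add0r.
  by rewrite (derive_lin _ _ (@line_continuous _ v)) /=; exact: scale1r.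
split; first by apply: diff_derivable; exact: (differentiable_comp dl df).
by have := derive_comp (1 : R^o) dl df; rewrite Dl => <-.
Qed.

(** The mean value theorem along [v] turns the second difference into a difference of two values of
    ['D_v f]; the first-order expansion of ['D_v f] at [p] then compares both with the value at
    [p]. *)
Lemma second_difference_le (f : E -> R) W (p v w : E) (e : R) :
  open W -> W p -> (forall x, W x -> differentiable f x) ->
  differentiable ('D_v f) p -> 0 < e ->
  exists2 d, 0 < d & forall t, 0 < t < d ->
    `|second_difference f p v w t - t ^+ 2 * 'D_w ('D_v f) p| <= e * t ^+ 2.
Proof.
move=> oW Wp df ddf e0.
(* The two expansion errors occur at displacements of length at most [t (|v| + |w|)] and [t |v|],
   whence [2 |v| + |w|]; the added 1 makes [K] positive. *)
set K : R := 2 * `|v| + `|w| + 1.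
have K0 : 0 < K by rewrite /K ltr_wpDl// addr_ge0// mulr_ge0.
set g := 'D_v f.
have [r r0 Wr] : exists2 r, 0 < r & forall h, `|h| < r -> W (p + h).
  have : nbhs p W by exact: open_nbhs_nbhs.
  move=> /nbhs_ballP[r /= r0 rW]; exists r => // h hr; apply: rW.
  by rewrite -ball_normE /ball_/= opprD addNKr normrN.
have [s s0 gs] : exists2 s, 0 < s & forall h, `|h| < s ->
    `|g (p + h) - g p - 'd g p h| <= (e / K) * `|h|.
  have /diff_locallyP[_ /eqaddoP] := ddf.
  have eK : 0 < e / K by rewrite divr_gt0.
  move=> /(_ _ eK) /nbhs_ballP[s /= s0 sW]; exists s => // h hs.
  have /= := sW h; rewrite -ball_normE /ball_/= sub0r normrN => /(_ hs).
  by rewrite !fctE opprD addrA [h + p]addrC.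
exists (Num.min r s / K) => [|t /andP[t0 td]].
  by rewrite divr_gt0// lt_min r0 s0.
have tK : t * K < r /\ t * K < s.
  by move: td; rewrite ltr_pdivlMr// lt_min => /andP[].
have nb c b : 0 <= c <= t -> 0 <= b <= t ->
    `|c *: v + b *: w| <= t * (`|v| + `|w|) /\ t * (`|v| + `|w|) <= t * K.
  move=> /andP[c0 ct] /andP[b0 bt]; split.
    rewrite (le_trans (ler_normD _ _))// !normrZ !ger0_norm// mulrDr.
    by rewrite lerD// ler_wpM2r.
  rewrite ler_pM2l// /K.
  by have := normr_ge0 v; have := normr_ge0 w; lra.
(* The increment of [phi] over [[0, t]] is the second difference, and its derivative compares
   ['D_v f] at two points that differ by [t *: w]. *)
pose phi := fun b : R => f (p + t *: w + b *: v) - f (p + b *: v).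
have tt : 0 <= t <= t by rewrite lexx ltW.
have t00 : 0 <= (0 : R) <= t by rewrite lexx ltW.
have W1 c : 0 <= c <= t -> W (p + t *: w + c *: v) /\ W (p + c *: v).
  move=> ct; split.
    rewrite -addrA; apply: Wr; rewrite [X in `|X|]addrC.
    by have [h1 h2] := nb c t ct tt; apply: le_lt_trans h1 _; apply: le_lt_trans h2 _; case: tK.
  apply: Wr; rewrite -[c *: v]addr0 -(scale0r w).
  by have [h1 h2] := nb c 0 ct t00; apply: le_lt_trans h1 _; apply: le_lt_trans h2 _; case: tK.
have dphi c : 0 <= c <= t ->
   is_derive c 1 phi (g (p + t *: w + c *: v) - g (p + c *: v)).
  by move=> /W1[Wa Wb]; apply: is_deriveB; apply: is_derive_line; exact: df.
have [||c] := @MVT _ phi (fun c => g (p + t *: w + c *: v) - g (p + c *: v)) 0 t t0.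
- by move=> x; rewrite in_itv /= => /andP[x0 xt]; apply: dphi; rewrite !ltW.
- apply: derivable_within_continuous => x; rewrite in_itv /= => xt.
  by have [] := dphi x xt.
rewrite in_itv /= => /andP[c0 ct]; rewrite subr0 => phit.
have -> : second_difference f p v w t = phi t - phi 0.
  by rewrite /second_difference /phi scale0r !addr0 (addrAC p).
rewrite phit.
have c01 : 0 <= c <= t by rewrite !ltW.
(* The term [0 *: w] gives both remainders the same shape; their linear parts differ by exactly [t]
   times the differential of [g] at [w]. *)
have -> : (g (p + t *: w + c *: v) - g (p + c *: v)) * t - t ^+ 2 * 'D_w g p =
   ((g (p + (c *: v + t *: w)) - g p - 'd g p (c *: v + t *: w)) -
    (g (p + (c *: v + 0 *: w)) - g p - 'd g p (c *: v + 0 *: w))) * t.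
  have dE a b : 'd g p (a *: v + b *: w) = a * 'd g p v + b * 'd g p w.
    by rewrite linearD !linearZ.
  rewrite deriveE// !dE scale0r addr0 (addrC (c *: v)) addrA.
  by ring.
rewrite normrM (ger0_norm (ltW t0)) expr2 mulrA ler_pM2r//.
have [h1 h1'] := nb c t c01 tt; have [h2 h2'] := nb c 0 c01 t00.
rewrite (le_trans (ler_normB _ _))//.
have g1 := gs _ (le_lt_trans (le_trans h1 h1') tK.2).
have g2 := gs _ (le_lt_trans (le_trans h2 h2') tK.2).
apply: (le_trans (lerD g1 g2)).
rewrite -mulrDr -mulrA ler_pM2l// mulrC ler_pdivrMr//.
have h2'' : `|c *: v + 0 *: w| <= t * `|v|.
  by rewrite scale0r addr0 normrZ ger0_norm ?ler_wpM2r// ltW.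
apply: (le_trans (lerD h1 h2'')).
rewrite -mulrDr ler_pM2l// /K.
by have := normr_ge0 v; have := normr_ge0 w; lra.
Qed.

(** The expansion [D t = a t^2 + o(t^2)] as [t] tends to 0 from the right. Since the second
    difference is symmetric in [v] and [w], uniqueness of this coefficient yields the symmetry of
    second derivatives. *)
Definition quadratic_coef (D : R -> R) (a : R) := forall e, 0 < e ->
  exists2 d, 0 < d & forall t, 0 < t < d -> `|D t - t ^+ 2 * a| <= e * t ^+ 2.

Lemma quadratic_coef_unique (D : R -> R) (a b : R) :
  quadratic_coef D a -> quadratic_coef D b -> a = b.
Proof.
move=> Da Db; apply/eqP; rewrite -subr_eq0 -normr_eq0 eq_le normr_ge0 andbT.
apply/ler_addgt0Pr => e e0; rewrite add0r.
have e2 : 0 < e / 2 by rewrite divr_gt0.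
have [d1 d10 H1] := Da _ e2; have [d2 d20 H2] := Db _ e2.
set t := Num.min d1 d2 / 2.
have m0 : 0 < Num.min d1 d2 by rewrite lt_min d10.
have t0 : 0 < t by rewrite divr_gt0.
have tm : t < Num.min d1 d2 by rewrite ltr_pdivrMr// ltr_pMr// ltr1n.
have /H1 h1 : 0 < t < d1 by rewrite t0 (lt_le_trans tm)// ge_min lexx.
have /H2 h2 : 0 < t < d2 by rewrite t0 (lt_le_trans tm)// ge_min lexx orbT.
have t20 : 0 < t ^+ 2 by rewrite exprn_gt0.
rewrite -(ler_pM2r t20) -[X in _ * X <= _](gtr0_norm t20) -normrM.
have -> : (a - b) * t ^+ 2 = (D t - t ^+ 2 * b) - (D t - t ^+ 2 * a) by ring.
apply: (le_trans (ler_normB _ _)).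
have -> : e * t ^+ 2 = e / 2 * t ^+ 2 + e / 2 * t ^+ 2 by rewrite -mulrDl -splitr.
exact: lerD.
Qed.

Lemma derive_derive_comm_scalar (f : E -> R) W (p v w : E) :
  open W -> W p -> (forall x, W x -> differentiable f x) ->
  differentiable ('D_v f) p -> differentiable ('D_w f) p ->
  'D_w ('D_v f) p = 'D_v ('D_w f) p.
Proof.
move=> oW Wp df dv dw.
apply: (@quadratic_coef_unique (second_difference f p v w)) => e e0.
  exact: second_difference_le oW Wp df dv e0.
have [d d0 H] := second_difference_le v oW Wp df dw e0.
by exists d => // t /H; rewrite second_differenceC.
Qed.

Lemma derive_coord n (g : E -> 'rV[R]_n.+1) (u x : E) (i : 'I_n.+1) :
  differentiable g x -> 'D_u g x 0 i = 'D_u (fun y => g y 0 i) x.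
Proof. by move=> dg; rewrite derive_mx ?mxE//; exact: diff_derivable. Qed.

Lemma derive_derive_comm n (f : E -> 'rV[R]_n.+1) W (p v w : E) :
  open W -> W p -> Ck 2 W f -> 'D_w ('D_v f) p = 'D_v ('D_w f) p.
Proof.
move=> oW Wp cf; have [df Df] := cf.
apply/rowP => i.
have [df' Df'] := Ck_coord i oW cf.
have D2 u u' : 'D_u ('D_u' f) p 0 i = 'D_u ('D_u' (fun y => f y 0 i)) p.
  have -> := @derive_coord n ('D_u' f) u p i ((Df u').1 p Wp).
  apply: near_eq_derive; apply: filterS (open_nbhs_nbhs (conj oW Wp)) => y Wy.
  exact: (@derive_coord n f u' y i (df y Wy)).
apply: etrans (D2 w v) _; apply: etrans _ (esym (D2 v w)).
by apply: (derive_derive_comm_scalar oW Wp df'); [exact: (Df' _).1|exact: (Df' _).1].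
Qed.
End Schwarz.

End Calculus.

Section Geometry.
Variable R : realType.

(** * Smooth maps on open sets *)

Section SmoothOn.
Variable m : nat.
Local Notation E := 'rV[R]_m.+1.
Implicit Types (V : normedModType R) (U W : set E).

Lemma smooth_on_differentiable V W (f : E -> V) x :
  smooth_on W f -> W x -> differentiable f x.
Proof. by move=> /(_ 1%N) [df _]; exact: df. Qed.

Lemma smooth_on_continuous V W (f : E -> V) x :
  smooth_on W f -> W x -> {for x, continuous f}.
Proof. by move=> /(_ 0%N); exact. Qed.

Lemma smooth_on_derive V W (f : E -> V) v :
  smooth_on W f -> smooth_on W ('D_v f).
Proof. by move=> sf k; have [_ +] := sf k.+1; exact. Qed.

Lemma smooth_on_subset V W W' (f : E -> V) :
  W' `<=` W -> smooth_on W f -> smooth_on W' f.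
Proof. by move=> WW' sf k; exact: Ck_subset (sf k). Qed.

Lemma smooth_on_eq V W (f g : E -> V) : open W ->
  (forall x, W x -> f x = g x) -> smooth_on W f -> smooth_on W g.
Proof. by move=> oW fg sf k; exact: Ck_eq (sf k). Qed.

Lemma smooth_on_local V W (f : E -> V) :
  (forall x, W x -> exists W', [/\ open W', W' x & smooth_on W' f]) ->
  smooth_on W f.
Proof.
by move=> loc k; apply: Ck_local => x /loc [W' [oW W'x sf]]; exists W'.
Qed.

Lemma smooth_on_id W : smooth_on W (@id E).
Proof.
have di k (v : E) : Ck k W ('D_v (@id E)).
  rewrite (_ : 'D_v id = cst v); first exact: Ck_cst.
  by apply/funext => x; rewrite derive_id.
case=> [|k]; first by move=> x _; exact: cvg_id.
by split=> [x _|v]; [exact: ex_diff|exact: di].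
Qed.

Lemma open_preimage_on (T : topologicalType) U (D : set T) (f : E -> T) :
  (forall x, U x -> {for x, continuous f}) -> open U -> open D ->
  open (U `&` f @^-1` D).
Proof.
move=> cf; rewrite !openE => oU oD x [Ux Dfx].
by apply: filterI; [exact: oU|exact: (cf x Ux _ (oD _ Dfx))].
Qed.

End SmoothOn.

Lemma smooth_on_comp m n l (U : set 'rV[R]_m.+1) (W : set 'rV[R]_n.+1)
    (g : 'rV[R]_m.+1 -> 'rV[R]_n.+1) (f : 'rV[R]_n.+1 -> 'rV[R]_l.+1) :
  open U -> open W -> (forall x, U x -> W (g x)) ->
  smooth_on U g -> smooth_on W f -> smooth_on U (f \o g).
Proof. by move=> oU oW UW sg sf k; exact: (Ck_comp_row oU oW UW). Qed.

(** * Local smooth extensions of maps defined on a subset *)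

Section SmoothExtension.
Variables (m : nat) (M : set 'rV[R]_m.+1).
Local Notation E := 'rV[R]_m.+1.
Implicit Types (V : normedModType R) (p : E).

(** Common pattern for sums, products and scalings: intersect the two domains, and use that the
    value of the operation at a point depends only on the values there. *)
Lemma smooth_extension_bin V1 V2 V3 (op : (E -> V1) -> (E -> V2) -> E -> V3)
    p f f' g g' :
  (forall W h k, open W -> smooth_on W h -> smooth_on W k ->
     smooth_on W (op h k)) ->
  (forall q h h' k k', h q = h' q -> k q = k' q -> op h k q = op h' k' q) ->
  smooth_extension M f p f' -> smooth_extension M g p g' ->
  smooth_extension M (op f g) p (op f' g').
Proof.
move=> opS opE [W1 [oW1 W1p sf ef]] [W2 [oW2 W2p sg eg]].
have oW : open (W1 `&` W2) by exact: openI.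
exists (W1 `&` W2); split=> //.
  by apply: opS => //; [exact: smooth_on_subset sf|exact: smooth_on_subset sg].
by move=> q [W1q W2q] Mq; apply: opE; [exact: ef|exact: eg].
Qed.

Lemma smooth_extensionD V p (f f' g g' : E -> V) :
  smooth_extension M f p f' -> smooth_extension M g p g' ->
  smooth_extension M (f + g) p (f' + g').
Proof.
apply: (smooth_extension_bin (op := fun h k => h + k)).
  by move=> W h k oW sh sk n; exact: CkD.
by move=> q h h' k k'; rewrite !fctE => -> ->.
Qed.

Lemma smooth_extensionM p (f f' g g' : E -> R) :
  smooth_extension M f p f' -> smooth_extension M g p g' ->
  smooth_extension M (fun q => f q * g q) p (fun q => f' q * g' q).
Proof.
apply: (smooth_extension_bin (op := fun (h k : E -> R) q => h q * k q)).
  by move=> W h k oW sh sk n; exact: CkM.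
by move=> q h h' k k' /= -> ->.
Qed.

Lemma smooth_extension_on V W (f : E -> V) p : open W -> W p ->
  smooth_on W f -> smooth_extension M f p f.
Proof. by move=> oW Wp sf; exists W. Qed.

Lemma smooth_extension_cst V p (a : V) : smooth_extension M (cst a) p (cst a).
Proof.
apply: (@smooth_extension_on _ setT) => //; first exact: openT.
by move=> k; exact: Ck_cst.
Qed.

Lemma smooth_extension_id p : smooth_extension M id p id.
Proof.
by apply: (@smooth_extension_on _ setT) => //; [exact: openT|exact: smooth_on_id].
Qed.

Lemma smooth_extension_lin V V' (L : {linear V -> V'}) p (f f' : E -> V) :
  continuous L -> smooth_extension M f p f' ->
  smooth_extension M (L \o f) p (L \o f').
Proof.
move=> Lc [W [oW Wp sf ef]]; exists W; split=> //; first by move=> k; exact: Ck_lin.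
by move=> q Wq Mq /=; rewrite ef.
Qed.

Lemma smooth_extension_coord n p (f f' : E -> 'rV[R]_n.+1) i :
  smooth_extension M f p f' ->
  smooth_extension M (fun q => f q 0 i : R) p (fun q => f' q 0 i).
Proof.
exact: (@smooth_extension_lin _ _ (@row_coord R n i) p f f' (@row_coord_continuous R n i)).
Qed.

Lemma smooth_extension_sum n V p (f f' : 'I_n -> E -> V) :
  (forall i, smooth_extension M (f i) p (f' i)) ->
  smooth_extension M (\sum_i f i) p (\sum_i f' i).
Proof.
move=> ef; elim/big_ind2: _ => //; first exact: smooth_extension_cst.
by move=> *; exact: smooth_extensionD.
Qed.

Lemma smooth_extensionZ n p (a a' : E -> R) (f f' : E -> 'rV[R]_n.+1) :
  smooth_extension M a p a' -> smooth_extension M f p f' ->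
  smooth_extension M (fun q => a q *: f q) p (fun q => a' q *: f' q).
Proof.
apply: (smooth_extension_bin (op := fun (h : E -> R) (k : E -> 'rV_n.+1) q => h q *: k q)).
  move=> W h k oW sh sk l; apply: Ck_row => // i.
  apply: (@Ck_eq _ _ _ _ _ (fun x => h x * k x 0 i)) => // [x _|]; first by rewrite mxE.
  by apply: CkM => //; exact: Ck_coord.
by move=> q h h' k k' /= -> ->.
Qed.

Lemma smooth_extensionN V p (f f' : E -> V) :
  smooth_extension M f p f' -> smooth_extension M (- f) p (- f').
Proof.
move=> ef; have oc : continuous (@GRing.opp V) by exact: opp_continuous.
exact: (@smooth_extension_lin _ _ (@GRing.opp V) _ _ _ oc ef).
Qed.

Lemma smooth_extension_eq V p (f g f' : E -> V) :
  (forall q, M q -> f q = g q) ->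
  smooth_extension M f p f' -> smooth_extension M g p f'.
Proof.
by move=> fg [W [oW Wp sf ef]]; exists W; split=> // q Wq Mq; rewrite -fg// ef.
Qed.

Lemma smooth_extension_atE V p (f f' : E -> V) :
  M p -> smooth_extension M f p f' -> f' p = f p.
Proof. by move=> Mp [W [_ Wp _]]; exact. Qed.

Lemma smooth_extension_differentiable V p (f f' : E -> V) :
  smooth_extension M f p f' -> differentiable f' p.
Proof. by move=> [W [_ Wp sf _]]; exact: smooth_on_differentiable sf Wp. Qed.

End SmoothExtension.

Lemma smooth_extension_comp m n l (M : set 'rV[R]_m.+1) (N : set 'rV[R]_n.+1)
    (F F' : 'rV[R]_m.+1 -> 'rV[R]_n.+1) (f f' : 'rV[R]_n.+1 -> 'rV[R]_l.+1) p :
  M p -> (forall q, M q -> N (F q)) ->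
  smooth_extension M F p F' -> smooth_extension N f (F p) f' ->
  smooth_extension M (f \o F) p (f' \o F').
Proof.
move=> Mp MN eF [D [oD Dp sf ef]]; have [W [oW Wp sF eF']] := eF.
have oWD : open (W `&` F' @^-1` D).
  by apply: (open_preimage_on _ oW oD) => x; exact: smooth_on_continuous sF.
exists (W `&` F' @^-1` D); split=> //; first by split=> //=; rewrite eF'.
  by apply: (@smooth_on_comp _ _ _ _ D) => //; [move=> x []|apply: smooth_on_subset sF => x []].
by move=> q [Wq Dq] Mq /=; rewrite -eF'// ef// eF'//; exact: MN.
Qed.

Lemma smooth_on_comp_smooth m n l (U : set 'rV[R]_m.+1) (M : set 'rV[R]_n.+1)
    (x : 'rV[R]_m.+1 -> 'rV[R]_n.+1) (f : 'rV[R]_n.+1 -> 'rV[R]_l.+1) :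
  open U -> (forall a, U a -> M (x a)) -> smooth_on U x -> smooth M f ->
  smooth_on U (f \o x).
Proof.
move=> oU UM sx sf; apply: smooth_on_local => a Ua.
have [g [D [oD Dxa sg gf]]] := sf _ (UM a Ua).
have oUD : open (U `&` x @^-1` D).
  by apply: (open_preimage_on _ oU oD) => b; exact: smooth_on_continuous sx.
exists (U `&` x @^-1` D); split=> //.
apply: (@smooth_on_eq _ _ _ (g \o x)) => //.
  by move=> b [Ub Db] /=; rewrite gf//; exact: UM.
by apply: (@smooth_on_comp _ _ _ _ D) => //; [move=> b []|apply: smooth_on_subset sx => b []].
Qed.

Section Dot.
Local Notation E4 := 'rV[R]_4.
Implicit Types u v w : E4.

Lemma dotE u v : dot u v = \sum_i u 0 i * v 0 i.
Proof. by rewrite /dot mxE; apply: eq_bigr => i _; rewrite mxE. Qed.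

Lemma dotC u v : dot u v = dot v u.
Proof. by rewrite !dotE; apply: eq_bigr => i _; rewrite mulrC. Qed.

Lemma dotDl u v w : dot (u + v) w = dot u w + dot v w.
Proof. by rewrite /dot mulmxDl mxE. Qed.

Lemma dotZl a u w : dot (a *: u) w = a * dot u w.
Proof. by rewrite /dot -scalemxAl mxE. Qed.

Lemma dotNl u w : dot (- u) w = - dot u w.
Proof. by rewrite /dot mulNmx mxE. Qed.

Lemma dotBl u v w : dot (u - v) w = dot u w - dot v w.
Proof. by rewrite dotDl dotNl. Qed.

Lemma dot0l w : dot 0 w = 0.
Proof. by rewrite /dot mul0mx mxE. Qed.

Lemma dotDr u v w : dot u (v + w) = dot u v + dot u w.
Proof. by rewrite !(dotC u) dotDl. Qed.

Lemma dotZr a u w : dot u (a *: w) = a * dot u w.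
Proof. by rewrite !(dotC u) dotZl. Qed.

Lemma dotNr u w : dot u (- w) = - dot u w.
Proof. by rewrite !(dotC u) dotNl. Qed.

Lemma dotBr u v w : dot u (v - w) = dot u v - dot u w.
Proof. by rewrite !(dotC u) dotBl. Qed.

Lemma dot0r w : dot w 0 = 0.
Proof. by rewrite dotC dot0l. Qed.

Lemma dot_eq0 u : (dot u u == 0) = (u == 0).
Proof.
apply/eqP/eqP => [|->]; last exact: dot0l.
rewrite dotE => /eqP; rewrite psumr_eq0 => [/allP u0|i _]; last exact: sqr_ge0.
apply/rowP => i; rewrite mxE; apply/eqP.
by have := u0 i (mem_index_enum i); rewrite /= mulf_eq0 orbb.
Qed.

End Dot.

(** * Derivatives along tangent vectors *)

Section TangentDerivative.
Local Notation E4 := 'rV[R]_4.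
Implicit Types (M N : set E4) (p v : E4) (V : normedModType R).

Lemma is_derive_curve V (g : E4 -> V) (gamma : R -> E4) v p :
  gamma 0 = p -> is_derive (0 : R) (1 : R) gamma v -> differentiable g p ->
  is_derive (0 : R) (1 : R) (g \o gamma) ('D_v g p).
Proof.
move=> <- [gd <-] dg.
have dgam : differentiable gamma 0 by apply/derivable1_diffP.
split; first by apply: diff_derivable; exact: (differentiable_comp dgam dg).
exact: (derive_comp (1 : R^o) dgam dg).
Qed.

Lemma near_curve W (gamma : R -> E4) v p : gamma 0 = p ->
  is_derive (0 : R) (1 : R) gamma v -> open W -> W p ->
  \forall s \near 0, W (gamma s).
Proof.
move=> <- [gd _] oW W0.
have dgam : differentiable gamma 0 by apply/derivable1_diffP.
have := differentiable_continuous dgam; apply.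
exact: open_nbhs_nbhs.
Qed.

(** Along a curve in [M] with velocity [v] both extensions coincide with [f], and each directional
    derivative is the derivative along that curve. *)
Lemma smooth_extension_derive M V (f g h : E4 -> V) p v : tangent M p v ->
  smooth_extension M f p g -> smooth_extension M f p h -> 'D_v g p = 'D_v h p.
Proof.
move=> [gamma [g0 gM gd]] eg eh.
have [_ <-] := is_derive_curve g0 gd (smooth_extension_differentiable eg).
have [_ <-] := is_derive_curve g0 gd (smooth_extension_differentiable eh).
have [W1 [oW1 W1p _ gf]] := eg; have [W2 [oW2 W2p _ hf]] := eh.
apply: near_eq_derive.
have n1 : \forall s \near 0, W1 (gamma s) by exact: near_curve g0 gd oW1 W1p.
have n2 : \forall s \near 0, W2 (gamma s) by exact: near_curve g0 gd oW2 W2p.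
near=> s; rewrite /= gf ?hf//.
- by near: s.
- by near: s.
- by near: s.
- by near: s.
Unshelve. all: by end_near. Qed.

Lemma xget_smooth_extension M V (f : E4 -> V) p : smooth M f -> M p ->
  smooth_extension M f p (xget f [set g | smooth_extension M f p g]).
Proof.
by move=> sf Mp; have := @xgetPex _ f [set g | smooth_extension M f p g] (sf p Mp).
Qed.

(** The extension picked by [xget] inside [Dd] can be traded for any convenient one; every
    computation rule for [Dd] along tangent vectors goes through this. *)
Lemma DdE M V (f g : E4 -> V) p v : tangent M p v ->
  smooth_extension M f p g -> Dd M f p v = 'D_v g p.
Proof.
move=> Tv eg; apply: (smooth_extension_derive Tv) (eg).
exact: (@xgetI _ f [set h | smooth_extension M f p h] g eg).
Qed.

(** The extension chosen in [Dd] depends on [p] but not on the vector, so this is linearity of a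
    single differential, for arbitrary vectors of the ambient space. *)
Lemma Dd_linear M V (f : E4 -> V) p a u v : smooth M f -> M p ->
  Dd M f p (a *: u + v) = a *: Dd M f p u + Dd M f p v.
Proof.
move=> sf Mp.
have df := smooth_extension_differentiable (xget_smooth_extension sf Mp).
by rewrite /Dd !deriveE// linearP.
Qed.

(** Push a curve representing [v] forward by a local extension of [F]: near 0 it follows [F] on [M]
    and hence stays in [N]. *)
Lemma Dd_tangent M N (F : E4 -> E4) p v : smooth M F -> M p ->
  (forall q, M q -> N (F q)) -> tangent M p v ->
  tangent N (F p) (Dd M F p v).
Proof.
move=> sF Mp MN Tv; have [F' eF] := sF p Mp; rewrite (DdE Tv eF).
have [gamma [g0 gM gd]] := Tv.
have [W [oW Wp sF' F'F]] := eF.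
exists (F' \o gamma); split => /=.
- by rewrite g0 F'F.
- have n1 : \forall s \near 0, W (gamma s) by exact: near_curve g0 gd oW Wp.
  near=> s; rewrite F'F; last by near: s.
    by apply: MN; near: s.
  by near: s.
- exact: is_derive_curve g0 gd (smooth_extension_differentiable eF).
Unshelve. all: by end_near. Qed.

Variables (M : set E4) (p v : E4).
Hypotheses (Mp : M p) (Tv : tangent M p v).

Lemma eq_Dd V (f g : E4 -> V) : smooth M f -> (forall q, M q -> f q = g q) ->
  Dd M f p v = Dd M g p v.
Proof.
move=> sf fg; have [f' ef] := sf p Mp.
by rewrite (DdE Tv ef) (DdE Tv (smooth_extension_eq fg ef)).
Qed.

Lemma DdD V (f g : E4 -> V) : smooth M f -> smooth M g ->
  Dd M (fun q => f q + g q) p v = Dd M f p v + Dd M g p v.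
Proof.
move=> sf sg; have [f' ef] := sf p Mp; have [g' eg] := sg p Mp.
rewrite (DdE Tv ef) (DdE Tv eg) (DdE Tv (smooth_extensionD ef eg)).
apply: deriveD; apply: diff_derivable.
  exact: smooth_extension_differentiable ef.
exact: smooth_extension_differentiable eg.
Qed.

Lemma DdN V (f : E4 -> V) : smooth M f ->
  Dd M (fun q => - f q) p v = - Dd M f p v.
Proof.
move=> sf; have [f' ef] := sf p Mp.
rewrite (DdE Tv ef) (DdE Tv (smooth_extensionN ef)).
by apply: deriveN; apply: diff_derivable; exact: smooth_extension_differentiable ef.
Qed.

Lemma DdB V (f g : E4 -> V) : smooth M f -> smooth M g ->
  Dd M (fun q => f q - g q) p v = Dd M f p v - Dd M g p v.
Proof.
move=> sf sg; have [f' ef] := sf p Mp; have [g' eg] := sg p Mp.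
rewrite (DdE Tv ef) (DdE Tv eg) (DdE Tv (smooth_extensionD ef (smooth_extensionN eg))).
apply: deriveB; apply: diff_derivable.
  exact: smooth_extension_differentiable ef.
exact: smooth_extension_differentiable eg.
Qed.

Lemma DdZ n (f : E4 -> 'rV[R]_n.+1) (a : R) : smooth M f ->
  Dd M (fun q => a *: f q) p v = a *: Dd M f p v.
Proof.
move=> sf; have [f' ef] := sf p Mp.
rewrite (DdE Tv ef) (DdE Tv (smooth_extensionZ (smooth_extension_cst M p (a : R^o)) ef)).
by apply: deriveZ; apply: diff_derivable; exact: smooth_extension_differentiable ef.
Qed.

Lemma Dd_cst V (a : V) : Dd M (cst a) p v = 0.
Proof. by rewrite (DdE Tv (smooth_extension_cst M p a)) derive_cst. Qed.

Lemma Dd_id : Dd M id p v = v.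
Proof. by rewrite (DdE Tv (smooth_extension_id M p)) derive_id. Qed.

Lemma smooth_extension_dot (f f' g g' : E4 -> E4) :
  smooth_extension M f p f' -> smooth_extension M g p g' ->
  smooth_extension M (fun q => dot (f q) (g q)) p (fun q => dot (f' q) (g' q)).
Proof.
move=> ef eg.
have E (h k : E4 -> E4) : (fun q => dot (h q) (k q)) =
    \sum_i (fun q => h q 0 i * k q 0 i).
  by apply/funext => q; rewrite fct_sumE dotE.
rewrite !E; apply: smooth_extension_sum => i.
by apply: smooth_extensionM; exact: smooth_extension_coord.
Qed.

Lemma derive_dot (f g : E4 -> E4) : differentiable f p -> differentiable g p ->
  'D_v (fun q => dot (f q) (g q)) p = dot ('D_v f p) (g p) + dot (f p) ('D_v g p).
Proof.
move=> df dg.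
have dc (h : E4 -> E4) i : differentiable h p -> derivable (fun q => h q 0 i : R) p v.
  move=> dh; have dhv : derivable h p v by exact: diff_derivable.
  exact: (derivable_mxP h p v).1 dhv 0 i.
have -> : (fun q => dot (f q) (g q)) =
    \sum_i ((fun q => f q 0 i) * (fun q => g q 0 i)).
  by apply/funext => q; rewrite fct_sumE dotE.
rewrite derive_sum; last by move=> i; apply: derivableM; exact: dc.
rewrite !dotE -big_split; apply: eq_bigr => i _ /=.
rewrite (deriveM (dc f i df) (dc g i dg)) (derive_coord v i df) (derive_coord v i dg).
by rewrite addrC; congr (_ + _) => //; exact: mulrC.
Qed.

Lemma Dd_dot (f g : E4 -> E4) : smooth M f -> smooth M g ->
  Dd M (fun q => dot (f q) (g q)) p v = dot (Dd M f p v) (g p) + dot (f p) (Dd M g p v).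
Proof.
move=> sf sg; have [f' ef] := sf p Mp; have [g' eg] := sg p Mp.
rewrite (DdE Tv ef) (DdE Tv eg) (DdE Tv (smooth_extension_dot ef eg)) derive_dot.
- by rewrite (smooth_extension_atE Mp ef) (smooth_extension_atE Mp eg).
- exact: smooth_extension_differentiable ef.
- exact: smooth_extension_differentiable eg.
Qed.

Lemma Dd_comp n N (F : E4 -> E4) (f : E4 -> 'rV[R]_n.+1) : smooth M F ->
  (forall q, M q -> N (F q)) -> smooth N f ->
  Dd M (f \o F) p v = Dd N f (F p) (Dd M F p v).
Proof.
move=> sF MN sf; have [F' eF] := sF p Mp; have [f' ef] := sf _ (MN p Mp).
rewrite (DdE (Dd_tangent sF Mp MN Tv) ef) (DdE Tv eF).
rewrite (DdE Tv (smooth_extension_comp Mp MN eF ef)) derive_comp.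
- by rewrite (smooth_extension_atE Mp eF).
- exact: smooth_extension_differentiable eF.
- rewrite (smooth_extension_atE Mp eF); exact: smooth_extension_differentiable ef.
Qed.

End TangentDerivative.

(** * Closure properties of smooth maps on a subset *)

Section SmoothMaps.
Variables (m : nat) (M : set 'rV[R]_m.+1).
Implicit Types V : normedModType R.

Lemma smooth_eq V (f g : 'rV[R]_m.+1 -> V) :
  (forall q, M q -> f q = g q) -> smooth M f -> smooth M g.
Proof. by move=> fg sf p /sf[f' ef]; exists f'; exact: smooth_extension_eq ef. Qed.

Lemma smooth_cst V (a : V) : smooth M (fun=> a).
Proof. by move=> p Mp; exists (cst a); exact: smooth_extension_cst. Qed.

Lemma smooth_id : smooth M id.
Proof. by move=> p Mp; exists id; exact: smooth_extension_id. Qed.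

Lemma smoothD V (f g : 'rV[R]_m.+1 -> V) : smooth M f -> smooth M g ->
  smooth M (fun q => f q + g q).
Proof.
move=> sf sg p Mp; have [f' ef] := sf p Mp; have [g' eg] := sg p Mp.
by exists (f' + g'); exact: smooth_extensionD.
Qed.

Lemma smoothN V (f : 'rV[R]_m.+1 -> V) : smooth M f -> smooth M (fun q => - f q).
Proof. by move=> sf p /sf[f' ef]; exists (- f'); exact: smooth_extensionN. Qed.

Lemma smoothB V (f g : 'rV[R]_m.+1 -> V) : smooth M f -> smooth M g ->
  smooth M (fun q => f q - g q).
Proof. by move=> sf sg; apply: smoothD => //; exact: smoothN. Qed.

Lemma smooth_scale n (a : 'rV[R]_m.+1 -> R) (f : 'rV[R]_m.+1 -> 'rV[R]_n.+1) :
  smooth M a -> smooth M f -> smooth M (fun q => a q *: f q).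
Proof.
move=> sa sf p Mp; have [a' ea] := sa p Mp; have [f' ef] := sf p Mp.
by exists (fun q => a' q *: f' q); exact: smooth_extensionZ.
Qed.

Lemma smoothM (a b : 'rV[R]_m.+1 -> R) : smooth M a -> smooth M b ->
  smooth M (fun q => a q * b q).
Proof.
move=> sa sb p Mp; have [a' ea] := sa p Mp; have [b' eb] := sb p Mp.
by exists (fun q => a' q * b' q); exact: smooth_extensionM.
Qed.

Lemma smoothV (a : 'rV[R]_m.+1 -> R) : (forall q, M q -> a q != 0) ->
  smooth M a -> smooth M (fun q => (a q)^-1).
Proof.
move=> a0 sa p Mp; have [a' [W [oW Wp sa' a'a]]] := sa p Mp.
have oD : open [set r : R | r != 0].
  rewrite (_ : [set r : R | r != 0] = ~` [set 0]).
    by apply: closed_openC; exact: closed_eq.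
  by apply/seteqP; split => r /= /eqP.
have oW' : open (W `&` a' @^-1` [set r : R | r != 0]).
  by apply: open_preimage_on oW oD => q; exact: smooth_on_continuous.
exists (fun q => (a' q)^-1), (W `&` a' @^-1` [set r : R | r != 0]); split=> //.
- by split=> //=; rewrite a'a// a0.
- move=> k; apply: CkV => //; first by move=> q [].
  by apply: Ck_subset (sa' k) => q [].
- by move=> q [Wq _] Mq; rewrite a'a.
Qed.

Lemma smooth_on_smooth V (W : set 'rV[R]_m.+1) (f : 'rV[R]_m.+1 -> V) :
  open W -> smooth_on W f -> smooth (M `&` W) f.
Proof. by move=> oW sf p [Mp Wp]; exists f, W. Qed.

Lemma smooth_local V (f : 'rV[R]_m.+1 -> V) :
  (forall p, M p -> exists W, [/\ open W, W p & smooth (M `&` W) f]) -> smooth M f.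
Proof.
move=> loc p Mp; have [W [oW Wp sf]] := loc p Mp.
have [f' [W' [oW' W'p sf' f'f]]] := sf p (conj Mp Wp).
exists f', (W `&` W'); split=> //; first exact: openI.
  by apply: smooth_on_subset sf' => q [].
by move=> q [Wq W'q] Mq; apply: f'f.
Qed.

Lemma smoothZ n a (f : 'rV[R]_m.+1 -> 'rV[R]_n.+1) :
  smooth M f -> smooth M (fun q => a *: f q).
Proof. exact: (smooth_scale (@smooth_cst R a)). Qed.

End SmoothMaps.

Lemma smooth_subset m (V : normedModType R) (M M' : set 'rV[R]_m.+1) (f : 'rV[R]_m.+1 -> V) :
  M' `<=` M -> smooth M f -> smooth M' f.
Proof.
move=> MM' sf p /MM'/sf[f' [W [oW Wp sf' f'f]]]; exists f', W; split=> // q Wq /MM'.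
exact: f'f.
Qed.

Lemma smooth_dot (M : set 'rV[R]_4) (f g : 'rV[R]_4 -> 'rV[R]_4) :
  smooth M f -> smooth M g -> smooth M (fun q => dot (f q) (g q)).
Proof.
move=> sf sg p Mp; have [f' ef] := sf p Mp; have [g' eg] := sg p Mp.
by exists (fun q => dot (f' q) (g' q)); exact: smooth_extension_dot.
Qed.

Lemma smooth_comp m n l (M : set 'rV[R]_m.+1) (N : set 'rV[R]_n.+1)
    (F : 'rV[R]_m.+1 -> 'rV[R]_n.+1) (f : 'rV[R]_n.+1 -> 'rV[R]_l.+1) :
  (forall q, M q -> N (F q)) -> smooth M F -> smooth N f -> smooth M (f \o F).
Proof.
move=> MN sF sf p Mp; have [F' eF] := sF p Mp; have [f' ef] := sf _ (MN p Mp).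
by exists (f' \o F'); exact: smooth_extension_comp eF ef.
Qed.

(** * Frames of a plane and orthogonal projection *)

Section Plane.
Local Notation E4 := 'rV[R]_4.

Definition plane_frame (S : E4 -> Prop) (x1 x2 : E4) : Prop :=
  (forall v, S v <-> exists a b, v = a *: x1 + b *: x2) /\
  (forall a b, a *: x1 + b *: x2 = 0 -> a = 0 /\ b = 0).

Definition gram (x1 x2 : E4) : R := dot x1 x1 * dot x2 x2 - dot x1 x2 ^+ 2.

(** Orthogonal projection onto the span of [x1] and [x2], from inverting the Gram matrix by Cramer's
    rule. The explicit formula makes the projection visibly smooth when the frame is smooth. *)
Definition frame_proj (x1 x2 w : E4) : E4 :=
  (gram x1 x2)^-1 *: (dot w x1 *: (dot x2 x2 *: x1 - dot x1 x2 *: x2) +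
                      dot w x2 *: (dot x1 x1 *: x2 - dot x1 x2 *: x1)).

Variables (S : E4 -> Prop) (x1 x2 : E4).
Hypothesis fr : plane_frame S x1 x2.

Lemma gram_neq0 : gram x1 x2 != 0.
Proof.
have [_ free] := fr.
apply/eqP => g0.
(* The squared norm of this vector is [dot x2 x2 * gram x1 x2], so a zero Gram determinant makes it
   vanish and contradicts freeness. *)
have u0 : dot x2 x2 *: x1 + (- dot x1 x2) *: x2 = 0.
  apply/eqP; rewrite -dot_eq0 !(dotDl, dotDr, dotZl, dotZr) (dotC x2 x1).
  apply/eqP; transitivity (dot x2 x2 * gram x1 x2); last by rewrite g0 mulr0.
  by rewrite /gram; ring.
have [/eqP] := free _ _ u0; rewrite dot_eq0 => /eqP x20 _.
have [_ /eqP] : (0 : R) = 0 /\ (1 : R) = 0.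
  by apply: free; rewrite x20 scaler0 addr0 scale0r.
by rewrite oner_eq0.
Qed.

Lemma frame_proj_mem w : S (frame_proj x1 x2 w).
Proof.
have [mem _] := fr; apply/mem.
exists ((gram x1 x2)^-1 * (dot w x1 * dot x2 x2 - dot w x2 * dot x1 x2)),
       ((gram x1 x2)^-1 * (dot w x2 * dot x1 x1 - dot w x1 * dot x1 x2)).
rewrite /frame_proj; apply/rowP => i; rewrite !mxE.
by move: (gram x1 x2)^-1 (dot w x1) (dot w x2) (dot x1 x1) (dot x1 x2) (dot x2 x2) => *; ring.
Qed.

Lemma frame_proj_ortho w v : S v -> dot (w - frame_proj x1 x2 w) v = 0.
Proof.
have g0 := gram_neq0.
move=> /(proj1 fr _)[a [b ->]]; rewrite dotBl /frame_proj.
rewrite !(dotDl, dotDr, dotZl, dotZr, dotNl) (dotC x2 x1).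
move: g0; rewrite /gram.
by move: (dot w x1) (dot w x2) (dot x1 x1) (dot x1 x2) (dot x2 x2) => A B C D E G0; field.
Qed.

End Plane.

(** * Tangent planes of a surface *)

Section Chart.
Local Notation E4 := 'rV[R]_4.
Local Notation E2 := 'rV[R]_2.
Variables (M W : set E4) (U : set E2) (x : E2 -> E4) (y : E4 -> E2).
Hypotheses (oW : open W) (oU : open U) (sx : smooth_on U x) (sy : smooth_on W y).
Hypotheses (xM : forall a, U a -> M (x a)).
Hypotheses (yx : forall a, U a -> W (x a) -> y (x a) = a).
Hypotheses (yU : forall q, W q -> U (y q)) (xy : forall q, W q -> M q -> x (y q) = q).

Lemma chart_tangent q w : W q -> M q -> tangent M q ('D_w x (y q)).
Proof.
move=> Wq Mq; have dx := smooth_on_differentiable sx (yU Wq).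
have dx0 : differentiable x (y q + 0 *: w) by rewrite scale0r addr0.
have D := is_derive_line dx0; rewrite scale0r addr0 in D.
exists (fun s => x (y q + s *: w)); split=> //; first by rewrite scale0r addr0 xy.
have [dl _] := is_derive_line (ex_diff : differentiable (@id E2) (y q + 0 *: w)).
have cl : {for 0, continuous (fun s : R => y q + s *: w)}.
  by apply: differentiable_continuous; apply/derivable1_diffP.
have : nbhs (y q + (0 : R) *: w) U.
  by rewrite scale0r addr0; apply: open_nbhs_nbhs; split=> //; exact: yU.
move=> /cl Us; have Us' : \forall s \near 0, U (y q + s *: w) by exact: Us.
by apply: filterS Us' => s; exact: xM.
Qed.

Lemma chart_retraction_smooth : smooth_on W (x \o y).
Proof. exact: smooth_on_comp sy sx. Qed.

Lemma chart_retraction_derive q v : W q ->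
  'D_v (x \o y) q = 'D_('D_v y q) x (y q).
Proof.
move=> Wq; apply: derive_comp; first exact: smooth_on_differentiable sy Wq.
exact: smooth_on_differentiable sx (yU Wq).
Qed.

Lemma tangent_retraction q v : W q -> tangent M q v -> 'D_v (x \o y) q = v.
Proof.
move=> Wq [gamma [g0 gM gd]].
have dr := smooth_on_differentiable chart_retraction_smooth Wq.
have [_ <-] := is_derive_curve g0 gd dr.
have [_ <-] := gd; apply: near_eq_derive.
have n1 : \forall s \near 0, W (gamma s) by exact: near_curve g0 gd oW Wq.
by near=> s; rewrite /= xy//; near: s; [exact: n1|exact: gM].
Unshelve. all: by end_near. Qed.

(** Spanning: a tangent vector is fixed by the derivative of [x \o y], so it lies in the image of
    the differential of [x]. Freeness: [y \o x] is the identity near [y q], so the differential of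
    [x] is injective. *)
Lemma chart_frame q : W q -> M q ->
  plane_frame (tangent M q) ('D_(delta_mx 0 0) x (y q)) ('D_(delta_mx 0 1) x (y q)).
Proof.
move=> Wq Mq; have dx := smooth_on_differentiable sx (yU Wq).
have dy := smooth_on_differentiable sy Wq.
have Dx w : 'D_w x (y q) = w 0 0 *: 'D_(delta_mx 0 0) x (y q) +
    w 0 1 *: 'D_(delta_mx 0 1) x (y q).
  rewrite (derive_basis w dx) big_ord_recl big_ord1.
  by rewrite (_ : lift ord0 ord0 = 1)//; exact/val_inj.
pose row2 (a b : R) : E2 := \row_i (if i == 0 then a else b).
have row2E a b : 'D_(row2 a b) x (y q) = a *: 'D_(delta_mx 0 0) x (y q) +
    b *: 'D_(delta_mx 0 1) x (y q) by rewrite Dx !mxE.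
split=> [v|a b].
  split=> [Tv|[a [b ->]]]; last by rewrite -row2E; exact: chart_tangent.
  exists ('D_v y q 0 0), ('D_v y q 0 1).
  by rewrite -Dx -chart_retraction_derive// tangent_retraction.
rewrite -row2E => D0.
have dyx : differentiable y (x (y q)) by rewrite xy.
have : 'D_(row2 a b) (y \o x) (y q) = 0 by rewrite derive_comp// D0 derive0.
have -> : 'D_(row2 a b) (y \o x) (y q) = 'D_(row2 a b) id (y q).
  apply: near_eq_derive.
  have oUW : open (U `&` x @^-1` W).
    by apply: open_preimage_on oU oW => b'; exact: smooth_on_continuous.
  have : nbhs (y q) (U `&` x @^-1` W).
    by apply: open_nbhs_nbhs; split=> //; split; [exact: yU|rewrite /= xy].
  by apply: filterS => c [Uc Wc] /=; rewrite yx.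
rewrite derive_id => /rowP r0; split; first by have := r0 0; rewrite !mxE.
by have := r0 1; rewrite !mxE.
Qed.

End Chart.

Section Surface.
Local Notation E4 := 'rV[R]_4.
Local Notation E2 := 'rV[R]_2.
Variable M : set E4.
Hypothesis surfM : is_surface M.

(** In [is_surface] the inverse chart is smooth only as a map on [M] intersected with [W]. Here it
    is replaced by a local extension, on an open set of the ambient space shrunk so that the
    extension takes values in [U]. *)
Lemma surface_chart p : M p ->
  exists (W : set E4) (U : set E2) (x : E2 -> E4) (y : E4 -> E2),
    [/\ open W, W p & open U] /\
    [/\ smooth_on U x, smooth_on W y & forall a, U a -> M (x a)] /\
    [/\ forall a, U a -> W (x a) -> y (x a) = a,
        forall q, W q -> U (y q) & forall q, W q -> M q -> x (y q) = q].
Proof.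
move=> Mp; have [W0 [U [x [y [[oW0 W0p oU] [sx sy xy yx]]]]]] := surfM Mp.
have [y' [W1 [oW1 W1p sy' y'y]]] := sy p (conj Mp W0p).
have oW1U : open (W1 `&` y' @^-1` U).
  by apply: open_preimage_on oW1 oU => q; exact: smooth_on_continuous.
exists (W0 `&` (W1 `&` y' @^-1` U)), U, x, y'; split; [split|split; split] => //.
- exact: openI.
- split=> //; split=> //=; rewrite (y'y p W1p (conj Mp W0p)).
  by have [] := yx p (conj Mp W0p).
- by apply: smooth_on_subset sy' => q [_ []].
- by move=> a /xy[[]].
- move=> a Ua [W0x [W1x _]]; have [MW yxa] := xy a Ua.
  by rewrite (y'y _ W1x MW).
- by move=> q [_ []].
- move=> q [W0q [W1q _]] Mq; rewrite (y'y q W1q (conj Mq W0q)).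
  by have [] := yx q (conj Mq W0q).
Qed.

Lemma surface_retraction p : M p -> exists (W : set E4) (r : E4 -> E4),
  [/\ open W, W p, smooth_on W r, forall q, W q -> M q -> r q = q &
      forall q v, W q -> M q -> tangent M q ('D_v r q)].
Proof.
move=> /surface_chart[W [U [x [y [[oW Wp oU] [[sx sy xM] [yx yU xy]]]]]]].
exists W, (x \o y); split=> //; first exact: chart_retraction_smooth oW oU sx sy yU.
move=> q v Wq Mq; rewrite (chart_retraction_derive sx sy yU v Wq).
exact: (chart_tangent oU sx xM yU xy).
Qed.

Lemma surface_frame p : M p -> exists (W : set E4) (x1 x2 : E4 -> E4),
  [/\ open W, W p, smooth_on W x1, smooth_on W x2 &
      forall q, W q -> M q -> plane_frame (tangent M q) (x1 q) (x2 q)].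
Proof.
move=> /surface_chart[W [U [x [y [[oW Wp oU] [[sx sy xM] [yx yU xy]]]]]]].
have sX i : smooth_on W ('D_(delta_mx 0 i) x \o y).
  by apply: (smooth_on_comp oW oU yU sy); exact: smooth_on_derive.
exists W, ('D_(delta_mx 0 0) x \o y), ('D_(delta_mx 0 1) x \o y); split=> //.
by move=> q Wq Mq; exact: (chart_frame oW oU sx sy xM yx yU xy).
Qed.

End Surface.

(** * Planes in four-space and their orthogonal complements *)

Section PlaneDimension.
Local Notation E4 := 'rV[R]_4.
Implicit Types S : E4 -> Prop.

(** Turns a plane into the row space of a matrix of rank 2, so that dimension counts become
    statements on matrix ranks. *)
Lemma plane_frame_mx S x1 x2 : plane_frame S x1 x2 ->
  exists A : 'M[R]_(1 + 1, 4), \rank A = 2%N /\ forall v, S v <-> (v <= A)%MS.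
Proof.
move=> [mem free].
have mulE (w : 'rV[R]_(1 + 1)) : w *m col_mx x1 x2 = w 0 0 *: x1 + w 0 1 *: x2.
  rewrite -[w in LHS]hsubmxK mul_row_col [lsubmx w]mx11_scalar [rsubmx w]mx11_scalar.
  by rewrite !mul_scalar_mx !mxE; congr (w 0 _ *: _ + w 0 _ *: _); exact/val_inj.
pose row2 (a b : R) : 'rV[R]_(1 + 1) := row_mx a%:M b%:M.
have row2E a b : row2 a b *m col_mx x1 x2 = a *: x1 + b *: x2.
  by rewrite mul_row_col !mul_scalar_mx.
exists (col_mx x1 x2); split.
  apply/eqP/row_freeP; apply/row_freeP/inj_row_free => w.
  rewrite mulE => /free[w0 w1]; apply/rowP => i; rewrite mxE.
  by case: i => -[|[|//]] i; [rewrite -[RHS]w0|rewrite -[RHS]w1]; congr (w 0 _); exact/val_inj.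
move=> v; split=> [/mem[a [b ->]]|/submxP[w ->]]; last by apply/mem; rewrite mulE; do 2 eexists.
by rewrite -row2E submxMl.
Qed.

Lemma mx_plane_frame m (A : 'M[R]_(m, 4)) : \rank A = 2%N ->
  exists x1 x2, plane_frame (fun v => (v <= A)%MS) x1 x2.
Proof.
move=> rA; have := eq_row_base A; have := row_base_free A.
move: (row_base A); rewrite rA => B freeB eqB.
have mulE (w : 'rV[R]_2) : w *m B = w 0 0 *: row 0 B + w 0 1 *: row 1 B.
  rewrite mulmx_sum_row big_ord_recl big_ord1.
  by rewrite (_ : lift ord0 ord0 = 1)//; exact/val_inj.
pose row2 (a b : R) : 'rV[R]_2 := \row_i (if i == 0 then a else b).
have row2E a b : row2 a b *m B = a *: row 0 B + b *: row 1 B by rewrite mulE !mxE.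
exists (row 0 B), (row 1 B); split=> [v|a b].
  rewrite -eqB; split=> [/submxP[w ->]|[a [b ->]]]; last by rewrite -row2E submxMl.
  by rewrite mulE; do 2 eexists.
rewrite -row2E => /eqP; rewrite mulmx_free_eq0// => /eqP/rowP r0.
by split; [have := r0 0|have := r0 1]; rewrite !mxE.
Qed.

Lemma plane_frame_orthogonal S x1 x2 : plane_frame S x1 x2 ->
  exists n1 n2, plane_frame (fun u => forall v, S v -> dot u v = 0) n1 n2.
Proof.
move=> /plane_frame_mx[A [rA SA]].
(* The complement of the row space of [A] is the kernel of its transpose, of rank 4 - 2 = 2. *)
have [|n1 [n2 [mem free]]] := @mx_plane_frame _ (kermx A^T).
  by rewrite mxrank_ker mxrank_tr rA.
exists n1, n2; split=> // u; rewrite -mem; split=> [uS|/sub_kermxP uA v /SA/submxP[w ->]].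
  apply/sub_kermxP/rowP => i; rewrite mxE.
  have /SA/uS : (row i A <= A)%MS by exact: row_sub.
  by rewrite /dot tr_row colE mulmxA -colE !mxE => ->.
by rewrite /dot trmx_mul mulmxA uA mul0mx mxE.
Qed.

Lemma plane_frame_subset S S' x1 x2 y1 y2 : plane_frame S x1 x2 ->
  plane_frame S' y1 y2 -> (forall v, S v -> S' v) -> forall v, S' v -> S v.
Proof.
move=> /plane_frame_mx[A [rA SA]] /plane_frame_mx[B [rB SB]] SS' v /SB vB; apply/SA.
have AB : (A <= B)%MS.
  by apply/row_subP => i; apply/SB/SS'/SA; exact: row_sub.
by apply: submx_trans vB _; have [_ <-] := mxrank_leqif_sup AB; rewrite rA rB.
Qed.

Lemma plane_frame_ortho_line S x1 x2 c : plane_frame S x1 x2 -> S c -> c != 0 ->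
  exists d, [/\ S d, d != 0, dot c d = 0 &
    forall n, S n -> dot c n = 0 -> exists s, n = s *: d].
Proof.
move=> [mem free] Sc c0.
set p1 := dot c x1; set p2 := dot c x2.
have p0 : p1 ^+ 2 + p2 ^+ 2 != 0.
  apply: contra c0; rewrite paddr_eq0 ?sqr_ge0// !sqrf_eq0 => /andP[/eqP h1 /eqP h2].
  have [a [b cE]] := (mem c).1 Sc.
  by rewrite -dot_eq0 {2}cE dotDr !dotZr -/p1 -/p2 h1 h2 !mulr0 addr0.
(* Since [p1] and [p2] are the products of [c] with the frame, this is the frame combination whose
   product with [c] is [p2 p1 - p1 p2 = 0]. *)
exists (p2 *: x1 + (- p1) *: x2); split.
- by apply/mem; do 2 eexists.
- apply: contra p0 => /eqP/free[-> /eqP]; rewrite oppr_eq0 => /eqP ->.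
  by rewrite expr0n addr0.
- by rewrite dotDr !dotZr -/p1 -/p2; ring.
move=> n /mem[a [b ->]]; rewrite dotDr !dotZr -/p1 -/p2 => ab.
(* The coefficients [(a, b)] are orthogonal to [(p1, p2)], hence a multiple of [(p2, - p1)]; this is
   the coefficient of the projection onto that vector. *)
exists ((a * p2 - b * p1) / (p1 ^+ 2 + p2 ^+ 2)).
rewrite scalerDr !scalerA; congr (_ *: _ + _ *: _).
- apply: (mulIf p0); rewrite mulrAC divfK//.
  transitivity (a * p2 ^+ 2 + (a * p1 + b * p2) * p1 - b * p2 * p1); last by rewrite ab; ring.
  by ring.
- apply: (mulIf p0); rewrite mulrAC divfK//.
  transitivity (b * p1 ^+ 2 + (a * p1 + b * p2) * p2 - a * p1 * p2); last by rewrite ab; ring.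
  by ring.
Qed.

End PlaneDimension.

(** * Tangential and normal projections *)

Section Projection.
Local Notation E4 := 'rV[R]_4.
Variable M : set E4.
Hypothesis surfM : is_surface M.

Section Pointwise.
Variable p : E4.
Hypothesis Mp : M p.
Local Notation T := (tangent M p).
Local Notation N := (normal M p).
Local Notation tan := (tanpart M p).
Local Notation nor := (norpart M p).

Lemma tangent_frame : exists x1 x2, plane_frame T x1 x2.
Proof.
have [W [x1 [x2 [_ Wp _ _ fr]]]] := surface_frame surfM Mp.
by exists (x1 p), (x2 p); exact: fr.
Qed.

Lemma normal_frame : exists x1 x2, plane_frame N x1 x2.
Proof.
have [x1 [x2 fr]] := tangent_frame; have [n1 [n2 nfr]] := plane_frame_orthogonal fr.
by exists n1, n2.
Qed.

Lemma tangentZD a u v : T u -> T v -> T (a *: u + v).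
Proof.
have [x1 [x2 [mem _]]] := tangent_frame.
move=> /mem[b [c ->]] /mem[d [e ->]]; apply/mem; exists (a * b + d), (a * c + e).
by rewrite scalerDr !scalerA !scalerDl addrACA.
Qed.

Lemma tangent0 : T 0.
Proof.
have [x1 [x2 [mem _]]] := tangent_frame.
by apply/mem; exists 0, 0; rewrite !scale0r addr0.
Qed.

Lemma tangentZ a u : T u -> T (a *: u).
Proof. by move=> Tu; rewrite -[_ *: _]addr0; apply: tangentZD => //; exact: tangent0. Qed.

Lemma tangentD u v : T u -> T v -> T (u + v).
Proof. by move=> Tu Tv; rewrite -[u]scale1r; exact: tangentZD. Qed.

Lemma tangentN u : T u -> T (- u).
Proof. by move=> Tu; rewrite -scaleN1r; exact: tangentZ. Qed.

Lemma tangentB u v : T u -> T v -> T (u - v).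
Proof. by move=> Tu Tv; apply: tangentD => //; exact: tangentN. Qed.

Lemma normalZD a u v : N u -> N v -> N (a *: u + v).
Proof. by move=> Nu Nv w Tw; rewrite dotDl dotZl Nu// Nv// mulr0 addr0. Qed.

Lemma normal0 : N 0.
Proof. by move=> w _; exact: dot0l. Qed.

Lemma normalZ a u : N u -> N (a *: u).
Proof. by move=> Nu w Tw; rewrite dotZl Nu// mulr0. Qed.

Lemma normalD u v : N u -> N v -> N (u + v).
Proof. by move=> Nu Nv w Tw; rewrite dotDl Nu// Nv// addr0. Qed.

Lemma normalN u : N u -> N (- u).
Proof. by move=> Nu w Tw; rewrite dotNl Nu// oppr0. Qed.

Lemma normalB u v : N u -> N v -> N (u - v).
Proof. by move=> Nu Nv; apply: normalD => //; exact: normalN. Qed.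

Lemma tangent_normal_eq0 v : T v -> N v -> v = 0.
Proof. by move=> Tv Nv; apply/eqP; rewrite -dot_eq0; apply/eqP/Nv. Qed.

Lemma tanpart_eq w v : T v -> N (w - v) -> tan w = v.
Proof.
move=> Tv Nwv; apply: (@xget_subset1 _ 0 [set v | T v /\ N (w - v)]) => //.
move=> u1 u2 [T1 N1] [T2 N2]; apply/eqP; rewrite -subr_eq0; apply/eqP.
apply: tangent_normal_eq0; first exact: tangentB.
have -> : u1 - u2 = (w - u2) - (w - u1) by rewrite opprB [RHS]addrC subrKA.
exact: normalB.
Qed.

Lemma tanpart_frame x1 x2 w : plane_frame T x1 x2 -> tan w = frame_proj x1 x2 w.
Proof.
by move=> fr; apply: tanpart_eq; [exact: frame_proj_mem fr _|move=> v; exact: frame_proj_ortho].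
Qed.

Lemma tanpart_tangent w : T (tan w).
Proof.
by have [x1 [x2 fr]] := tangent_frame; rewrite (tanpart_frame _ fr); exact: frame_proj_mem fr _.
Qed.

Lemma norpart_normal w : N (nor w).
Proof.
have [x1 [x2 fr]] := tangent_frame; rewrite /norpart (tanpart_frame _ fr) => v.
exact: frame_proj_ortho.
Qed.

Lemma tanpartDnor w : tan w + nor w = w.
Proof. by rewrite /norpart addrC subrK. Qed.

Lemma tanpart_id v : T v -> tan v = v.
Proof. by move=> Tv; apply: tanpart_eq => //; rewrite subrr; exact: normal0. Qed.

Lemma tanpart_normal v : N v -> tan v = 0.
Proof. by move=> Nv; apply: tanpart_eq; [exact: tangent0|rewrite subr0]. Qed.

Lemma norpart_id v : N v -> nor v = v.
Proof. by move=> Nv; rewrite /norpart tanpart_normal// subr0. Qed.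

Lemma norpart_tangent v : T v -> nor v = 0.
Proof. by move=> Tv; rewrite /norpart tanpart_id// subrr. Qed.

Lemma tanpartZD a u v : tan (a *: u + v) = a *: tan u + tan v.
Proof.
apply: tanpart_eq; first by apply: tangentZD; exact: tanpart_tangent.
rewrite (_ : _ - _ = a *: nor u + nor v); first by apply: normalZD; exact: norpart_normal.
by rewrite /norpart scalerBr opprD addrACA.
Qed.

Lemma norpartZD a u v : nor (a *: u + v) = a *: nor u + nor v.
Proof. by rewrite /norpart tanpartZD scalerBr opprD addrACA. Qed.

Lemma norpartD u v : nor (u + v) = nor u + nor v.
Proof. by rewrite -{1}[u]scale1r norpartZD scale1r. Qed.

Lemma tanpartZ a u : tan (a *: u) = a *: tan u.
Proof. by rewrite -[a *: u]addr0 tanpartZD (tanpart_id tangent0) addr0. Qed.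

Lemma norpartZ a u : nor (a *: u) = a *: nor u.
Proof. by rewrite /norpart tanpartZ scalerBr. Qed.

Lemma norpartN u : nor (- u) = - nor u.
Proof. by rewrite -[- u]scaleN1r norpartZ scaleN1r. Qed.

Lemma norpartB u v : nor (u - v) = nor u - nor v.
Proof. by rewrite norpartD norpartN. Qed.

Lemma dot_tanpart w v : T v -> dot (tan w) v = dot w v.
Proof. by move=> Tv; rewrite -{2}(tanpartDnor w) dotDl norpart_normal// addr0. Qed.

Lemma dot_norpart w n : N n -> dot (nor w) n = dot w n.
Proof.
move=> Nn; rewrite -{2}(tanpartDnor w) dotDl [dot (tan w) n]dotC Nn ?add0r//.
exact: tanpart_tangent.
Qed.

Lemma tangent_eq u v : T u -> T v -> (forall w, T w -> dot u w = dot v w) -> u = v.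
Proof.
move=> Tu Tv uv; apply/eqP; rewrite -subr_eq0 -dot_eq0 dotBl.
by rewrite uv ?subrr//; exact: tangentB.
Qed.

Lemma normal_eq u v : N u -> N v -> (forall w, N w -> dot u w = dot v w) -> u = v.
Proof.
move=> Nu Nv uv; apply/eqP; rewrite -subr_eq0 -dot_eq0 dotBl.
by rewrite uv ?subrr//; exact: normalB.
Qed.

Lemma normal_normal_tangent w : (forall n, N n -> dot w n = 0) -> T w.
Proof.
move=> wN; have n0 : nor w = 0.
  apply: normal_eq; [exact: norpart_normal|exact: normal0|move=> n Nn].
  by rewrite dot_norpart// wN// dot0l.
by rewrite -(tanpartDnor w) n0 addr0; exact: tanpart_tangent.
Qed.

End Pointwise.

Lemma smooth_tanpart (V : E4 -> E4) : smooth M V -> smooth M (fun q => tanpart M q (V q)).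
Proof.
move=> sV; apply: smooth_local => p Mp.
have [W [x1 [x2 [oW Wp sx1 sx2 fr]]]] := surface_frame surfM Mp.
have s1 : smooth (M `&` W) x1 by exact: smooth_on_smooth.
have s2 : smooth (M `&` W) x2 by exact: smooth_on_smooth.
have sV' : smooth (M `&` W) V by apply: smooth_subset sV => q [].
exists W; split=> //.
(* Near [p] the projection, defined by choice, is the explicit Gram formula in a smooth frame,
   rational with nonvanishing denominator. *)
apply: (@smooth_eq _ _ _ (fun q => frame_proj (x1 q) (x2 q) (V q))).
  by move=> q [Mq Wq]; rewrite (tanpart_frame Mq _ (fr q Wq Mq)).
apply: smooth_scale.
  apply: smoothV => [q [Mq Wq]|]; first exact: gram_neq0 (fr q Wq Mq).
  have -> : (fun q => gram (x1 q) (x2 q)) = fun q => dot (x1 q) (x1 q) * dot (x2 q) (x2 q)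
      - dot (x1 q) (x2 q) * dot (x1 q) (x2 q) by apply/funext => q; rewrite /gram expr2.
  by apply: smoothB; apply: smoothM; exact: smooth_dot.
by apply: smoothD; apply: smooth_scale; try apply: smoothB; try apply: smooth_scale;
  try exact: smooth_dot.
Qed.

Lemma smooth_norpart (V : E4 -> E4) : smooth M V -> smooth M (fun q => norpart M q (V q)).
Proof. by move=> sV; apply: smoothB => //; exact: smooth_tanpart. Qed.

Lemma tangent_field_tanpart (V : E4 -> E4) : smooth M V ->
  tangent_field M (fun q => tanpart M q (V q)).
Proof. by move=> sV; split; [exact: smooth_tanpart|move=> p Mp; exact: tanpart_tangent]. Qed.

Lemma normal_section_norpart (V : E4 -> E4) : smooth M V ->
  normal_section M (fun q => norpart M q (V q)).
Proof. by move=> sV; split; [exact: smooth_norpart|move=> p Mp; exact: norpart_normal]. Qed.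

(* Projecting a constant field replaces the usual cut-off functions. *)
Lemma tangent_field_extend p v : M p -> tangent M p v ->
  exists X, tangent_field M X /\ X p = v.
Proof.
move=> Mp Tv; exists (fun q => tanpart M q v); split; last exact: tanpart_id.
by apply: tangent_field_tanpart; exact: smooth_cst.
Qed.

Lemma normal_section_extend p n : M p -> normal M p n ->
  exists u, normal_section M u /\ u p = n.
Proof.
move=> Mp Nn; exists (fun q => norpart M q n); split; last exact: norpart_id.
by apply: normal_section_norpart; exact: smooth_cst.
Qed.

End Projection.

(** * The second fundamental form *)

Section SecondDerivative.
Local Notation E4 := 'rV[R]_4.
Variable M : set E4.
Implicit Types (X Y : E4 -> E4).

(** A local extension of the derivative of [f] along the varying field [X], written in partial
    derivatives so that it is smooth and can be differentiated again. *)
Definition directional (f X : E4 -> E4) : E4 -> E4 :=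
  fun q => \sum_i X q 0 i *: 'D_(delta_mx 0 i) f q.

Lemma smooth_extension_Dd (f f' X X' : E4 -> E4) p : tangent_field M X ->
  smooth_extension M f p f' -> smooth_extension M X p X' ->
  smooth_extension M (fun q => Dd M f q (X q)) p (directional f' X').
Proof.
move=> [_ TX] ef eX.
have [W1 [oW1 W1p sf f'f]] := ef; have [W2 [oW2 W2p sX X'X]] := eX.
have eD i : smooth_extension M ('D_(delta_mx 0 i) f') p ('D_(delta_mx 0 i) f').
  by exists W1; split=> //; exact: smooth_on_derive.
have [W3 [oW3 W3p sD _]] : smooth_extension M (directional f' X') p (directional f' X').
  have -> : directional f' X' = \sum_i (fun q => X' q 0 i *: 'D_(delta_mx 0 i) f' q).
    by apply/funext => q; rewrite fct_sumE.
  apply: smooth_extension_sum => i; apply: smooth_extensionZ => //.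
  apply: smooth_extension_coord; exists W2; split=> //.
exists (W1 `&` W2 `&` W3); split.
- by apply: openI => //; exact: openI.
- by [].
- by apply: smooth_on_subset sD => q [].
move=> q [[W1q W2q] W3q] Mq.
have efq : smooth_extension M f q f' by exists W1.
rewrite (DdE (TX q Mq) efq) /directional (X'X q W2q Mq).
by rewrite (derive_basis (X q) (smooth_extension_differentiable efq)).
Qed.

Lemma smooth_Dd (f X : E4 -> E4) : smooth M f -> tangent_field M X ->
  smooth M (fun q => Dd M f q (X q)).
Proof.
move=> sf TX p Mp; have [f' ef] := sf p Mp; have [X' eX] := TX.1 p Mp.
by exists (directional f' X'); exact: smooth_extension_Dd.
Qed.

Lemma differentiable_row_coord (f : E4 -> E4) p i : differentiable f p ->
  differentiable (fun q => f q 0 i : R) p.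
Proof. by move=> df; exact: (differentiable_comp df (differentiable_coord (f p) 0 i)). Qed.

Lemma differentiable_scale (a : E4 -> R) (f : E4 -> E4) p :
  differentiable a p -> differentiable f p -> differentiable (fun q => a q *: f q) p.
Proof.
move=> da df.
have -> : (fun q => a q *: f q) =
    \sum_i (line (delta_mx 0 i) \o (a * (fun q => f q 0 i))).
  apply/funext => q; rewrite fct_sumE {1}[f q]row_sum_delta scaler_sumr.
  by apply: eq_bigr => i _; rewrite scalerA.
apply: differentiable_sum => i; apply: differentiable_comp.
  by apply: differentiableM => //; exact: differentiable_row_coord.
by apply: linear_differentiable; exact: line_continuous.
Qed.

Lemma derive_scale (a : E4 -> R) (f : E4 -> E4) p v :
  differentiable a p -> differentiable f p ->
  'D_v (fun q => a q *: f q) p = 'D_v a p *: f p + a p *: 'D_v f p.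
Proof.
move=> da df; apply/rowP => i.
have dfi := differentiable_row_coord i df.
have dd := differentiable_scale da df.
rewrite (derive_coord v i dd) !mxE (derive_coord v i df).
have -> : (fun q => (a q *: f q) 0 i) = a * (fun q => f q 0 i).
  by apply/funext => q; rewrite mxE.
rewrite (deriveM (diff_derivable da) (diff_derivable dfi)) addrC.
by congr (_ + _) => //; exact: mulrC.
Qed.

Lemma derive_directional (f X : E4 -> E4) p v W : open W -> W p ->
  smooth_on W f -> differentiable X p ->
  'D_v (directional f X) p = 'D_('D_v X p) f p +
    \sum_i \sum_j (X p 0 i * v 0 j) *: 'D_(delta_mx 0 j) ('D_(delta_mx 0 i) f) p.
Proof.
move=> oW Wp sf dX.
have dXi i := differentiable_row_coord i dX.
have dDf i : differentiable ('D_(delta_mx 0 i) f) p.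
  exact: smooth_on_differentiable (smooth_on_derive _ sf) Wp.
have -> : directional f X = \sum_i (fun q => X q 0 i *: 'D_(delta_mx 0 i) f q).
  by apply/funext => q; rewrite fct_sumE.
rewrite derive_sum; last first.
  by move=> i; apply: diff_derivable; exact: differentiable_scale.
rewrite (derive_basis ('D_v X p) (smooth_on_differentiable sf Wp)) -big_split.
apply: eq_bigr => i _ /=.
rewrite (derive_scale v (dXi i) (dDf i)) (derive_coord v i dX); congr (_ + _).
apply: etrans (congr1 (fun z : E4 => X p 0 i *: z) (derive_basis v (dDf i))) _.
rewrite scaler_sumr; apply: eq_bigr => j _.
by rewrite scalerA.
Qed.

(** The second-order terms cancel by symmetry of second derivatives. The right side is stated with
    the extension [f'] because the tangency of the bracket is itself deduced from this lemma. *)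
Lemma Dd_Dd_comm (f f' X Y : E4 -> E4) p : M p -> smooth_extension M f p f' ->
  tangent_field M X -> tangent_field M Y ->
  Dd M (fun q => Dd M f q (Y q)) p (X p) - Dd M (fun q => Dd M f q (X q)) p (Y p) =
  'D_(bracket M X Y p) f' p.
Proof.
move=> Mp ef TX TY; have [X' eX] := TX.1 p Mp; have [Y' eY] := TY.1 p Mp.
have [W [oW Wp sf f'f]] := ef.
have dX := smooth_extension_differentiable eX.
have dY := smooth_extension_differentiable eY.
have df := smooth_extension_differentiable ef.
have TXp := TX.2 p Mp; have TYp := TY.2 p Mp.
have eXY := DdE TXp (smooth_extension_Dd TY ef eY).
have eYX := DdE TYp (smooth_extension_Dd TX ef eX).
apply: etrans (congr2 (fun u v : E4 => u - v) eXY eYX) _.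
rewrite (derive_directional (X p) oW Wp sf dY) (derive_directional (Y p) oW Wp sf dX).
rewrite (smooth_extension_atE Mp eX) (smooth_extension_atE Mp eY).
rewrite /bracket (DdE TXp eY) (DdE TYp eX).
(* Swapping the two summations and then the two partial derivatives makes both double sums equal. *)
have -> : \sum_i \sum_j (Y p 0 i * X p 0 j) *: 'D_(delta_mx 0 j) ('D_(delta_mx 0 i) f') p
   = \sum_i \sum_j (X p 0 i * Y p 0 j) *: 'D_(delta_mx 0 j) ('D_(delta_mx 0 i) f') p.
  rewrite exchange_big; apply: eq_bigr => i _; apply: eq_bigr => j _ /=.
  have h := derive_derive_comm (delta_mx 0 j) (delta_mx 0 i) oW Wp (sf 2%N).
  exact: (congr2 (fun (r : R) (u : E4) => r *: u) (mulrC _ _) h).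
have aux (a b c : E4) : a + c - (b + c) = a - b by rewrite opprD addrACA subrr addr0.
apply: etrans (aux _ _ _) _.
by rewrite !(deriveE _ df) linearB.
Qed.

End SecondDerivative.

(** * The Weingarten and Gauss equations *)

Section Extrinsic.
Local Notation E4 := 'rV[R]_4.
Variable M : set E4.
Hypothesis surfM : is_surface M.
Implicit Types (X Y Z u : E4 -> E4) (p v w n : E4).

(* A local retraction [r] onto [M] extends the identity, so that applying
   [D_X D_Y - D_Y D_X = D_[X,Y]] to it gives [[X,Y] = D_[X,Y] r]. *)
Lemma bracket_tangent X Y p : tangent_field M X -> tangent_field M Y -> M p ->
  tangent M p (bracket M X Y p).
Proof.
move=> TX TY Mp; have [W [r [oW Wp sr rid rT]]] := surface_retraction surfM Mp.
have er : smooth_extension M id p r by exists W.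
have Did Z q : tangent_field M Z -> M q -> Z q = Dd M id q (Z q).
  by move=> [_ TZ] Mq; rewrite Dd_id//; exact: TZ.
have eXY := eq_Dd Mp (TX.2 p Mp) TY.1 (fun q => Did Y q TY).
have eYX := eq_Dd Mp (TY.2 p Mp) TX.1 (fun q => Did X q TX).
have br : bracket M X Y p = 'D_(bracket M X Y p) r p.
  exact: etrans (congr2 (fun u v : E4 => u - v) eXY eYX) (Dd_Dd_comm Mp er TX TY).
by rewrite br; exact: rT.
Qed.

(** Differentiate [dot (Y q) (u q) = 0] along [v]. *)
Lemma weingarten Y u p v : tangent_field M Y -> normal_section M u -> M p ->
  tangent M p v -> dot (Dd M Y p v) (u p) = - dot (Y p) (Dd M u p v).
Proof.
move=> [sY TY] [su Nu] Mp Tv; apply/eqP; rewrite -addr_eq0; apply/eqP.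
apply: etrans (esym (Dd_dot Mp Tv sY su)) _; apply: etrans _ (Dd_cst Tv (0 : R)).
apply: (eq_Dd Mp Tv); first exact: smooth_dot.
by move=> q Mq; rewrite dotC Nu//; exact: TY.
Qed.

(** [alpha] takes fields; here the vector [w] is extended canonically by projecting a constant
    field, which gives a map on vectors that is amenable to linear algebra. *)
Definition second_form p v w : E4 :=
  norpart M p (Dd M (fun q => tanpart M q w) p v).

Local Notation II := second_form.

Lemma tangent_field_cst w : tangent_field M (fun q => tanpart M q w).
Proof. by apply: (tangent_field_tanpart surfM); exact: smooth_cst. Qed.

Lemma second_form_normal p v w : M p -> normal M p (II p v w).
Proof. by move=> Mp; exact: norpart_normal. Qed.

(** Tensoriality: tested against a normal section, the Weingarten equation moves the derivative from
    [Y] to that section, so that only the value [Y p] remains. *)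
Lemma alphaE X Y p : tangent_field M X -> tangent_field M Y -> M p ->
  alpha M X Y p = II p (X p) (Y p).
Proof.
move=> TX TY Mp; have TXp := TX.2 p Mp.
apply: normal_eq; [exact: norpart_normal|exact: norpart_normal|move=> n Nn].
have [u [Nu <-]] := normal_section_extend surfM Mp Nn.
have Nup := Nu.2 p Mp; have TcY := tangent_field_cst (Y p).
apply: etrans (dot_norpart surfM Mp _ Nup) _.
apply: etrans _ (esym (dot_norpart surfM Mp _ Nup)).
apply: etrans (weingarten TY Nu Mp TXp) _.
apply: etrans _ (esym (weingarten TcY Nu Mp TXp)).
by rewrite (tanpart_id surfM Mp (TY.2 p Mp)).
Qed.

(** The difference is the normal part of the bracket of two extending fields, and the bracket is
    tangent. *)
Lemma second_formC p v w : M p -> tangent M p v -> tangent M p w ->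
  II p v w = II p w v.
Proof.
move=> Mp Tv Tw.
have [X [TX <-]] := tangent_field_extend surfM Mp Tv.
have [Y [TY <-]] := tangent_field_extend surfM Mp Tw.
apply: etrans (esym (alphaE TX TY Mp)) _; apply: etrans _ (alphaE TY TX Mp).
apply: subr0_eq; apply: etrans (esym (norpartB surfM Mp _ _)) _.
exact: (norpart_tangent surfM Mp (bracket_tangent TX TY Mp)).
Qed.

Lemma second_formZDl p a (u v w : E4) : M p -> II p (a *: u + v) w = a *: II p u w + II p v w.
Proof.
move=> Mp; have sw := (tangent_field_cst w).1.
apply: etrans (congr1 (norpart M p) (Dd_linear a u v sw Mp)) _.
exact: (norpartZD surfM Mp).
Qed.

Lemma second_formZDr p a (u v w : E4) : M p -> tangent M p u -> tangent M p v ->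
  tangent M p w -> II p w (a *: u + v) = a *: II p w u + II p w v.
Proof.
move=> Mp Tu Tv Tw; have Tuv := tangentZD surfM Mp a Tu Tv.
rewrite [LHS](second_formC Mp Tw Tuv) [II p w u](second_formC Mp Tw Tu).
by rewrite [II p w v](second_formC Mp Tw Tv); exact: second_formZDl.
Qed.

Lemma second_formZl p a (v w : E4) : M p -> II p (a *: v) w = a *: II p v w.
Proof.
move=> Mp; have h0 : II p 0 w = 0.
  by have := second_formZDl (-1) 0 0 w Mp; rewrite scaler0 addr0 scaleN1r addNr.
by have := second_formZDl a v 0 w Mp; rewrite h0 !addr0.
Qed.

Lemma second_formZr p a (v w : E4) : M p -> tangent M p v -> tangent M p w ->
  II p w (a *: v) = a *: II p w v.
Proof.
move=> Mp Tv Tw; apply: etrans (second_formC Mp Tw (tangentZ surfM Mp a Tv)) _.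
apply: etrans (second_formZl a v w Mp) _.
exact: (congr1 (fun z : E4 => a *: z) (second_formC Mp Tv Tw)).
Qed.

(** Pointwise Weingarten equation: the tangential part of the derivative of a normal section is
    minus its shape operator. *)
Lemma dot_Dd_normal u p v w : normal_section M u -> M p -> tangent M p v ->
  tangent M p w -> dot (Dd M u p v) w = - dot (u p) (II p v w).
Proof.
move=> Nu Mp Tv Tw; have [Y [TY Yp]] := tangent_field_extend surfM Mp Tw.
have [X [TX Xp]] := tangent_field_extend surfM Mp Tv.
rewrite -Xp -Yp; have TXp := TX.2 p Mp.
apply: etrans _ (congr1 (fun n => - dot (u p) n) (alphaE TX TY Mp)).
apply: etrans _ (congr1 (@GRing.opp R) (dotC _ _)).
apply: etrans _ (congr1 (@GRing.opp R) (esym (dot_norpart surfM Mp _ (Nu.2 p Mp)))).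
apply: etrans _ (congr1 (@GRing.opp R) (esym (weingarten TY Nu Mp TXp))).
by rewrite opprK dotC.
Qed.

Lemma normal_section_alpha X Y : tangent_field M X -> smooth M Y ->
  normal_section M (alpha M X Y).
Proof. by move=> TX sY; apply: (normal_section_norpart surfM); exact: smooth_Dd. Qed.

(** Ambient derivatives commute up to the bracket, so curvature arises only from the normal terms
    dropped by [nablaT]; their derivatives have tangential parts given by shape operators. *)
Lemma gauss_equation X Y Z p w : tangent_field M X -> tangent_field M Y ->
  tangent_field M Z -> M p -> tangent M p w ->
  dot (curvature M X Y Z p) w =
  dot (II p (Y p) (Z p)) (II p (X p) w) - dot (II p (X p) (Z p)) (II p (Y p) w).
Proof.
move=> TX TY TZ Mp Tw.
have nablaE A B : tangent_field M A -> tangent_field M B ->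
    dot (nablaT M A (nablaT M B Z) p) w =
    dot (Dd M (fun q => Dd M Z q (B q)) p (A p)) w + dot (II p (B p) (Z p)) (II p (A p) w).
  move=> TA TB; rewrite {1}/nablaT dot_tanpart//.
  have TAp := TA.2 p Mp.
  have sB := smooth_Dd TZ.1 TB.
  have Na := normal_section_alpha TB TZ.1.
  (* Before the second differentiation, the tangential derivative is written as the ambient
     derivative minus [alpha], a normal section. *)
  rewrite -(eq_Dd Mp TAp (smoothB sB Na.1)); last first.
    by move=> q Mq; rewrite /nablaT /alpha -{1}(tanpartDnor M q (Dd M Z q (B q))) addrK.
  rewrite [X in dot X w = _](DdB Mp TAp sB Na.1).
  apply: etrans (dotBl _ _ _) _; apply: (congr2 +%R (erefl _)).
  apply: etrans (congr1 (@GRing.opp R) (dot_Dd_normal Na Mp TAp Tw)) _.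
  by rewrite opprK; exact: (congr1 (fun z : E4 => dot z _) (alphaE TB TZ Mp)).
have comm := Dd_Dd_comm Mp (xget_smooth_extension TZ.1 Mp) TX TY.
have comm' := etrans (congr1 (fun z : E4 => dot z w) (esym comm)) (dotBl _ _ _).
have hb := etrans (dot_tanpart surfM Mp (Dd M Z p (bracket M X Y p)) Tw) comm'.
have cE (a b c : E4) : dot (a - b - c) w = dot a w - dot b w - dot c w.
  by rewrite !dotBl.
apply: etrans (cE _ _ _) _.
apply: etrans (congr2 (fun a b => a - b)
  (congr2 (fun a b => a - b) (nablaE X Y TX TY) (nablaE Y X TY TX)) hb) _.
have aux (a b c d : R) : (a + c) - (b + d) - (a - b) = c - d by ring.
exact: aux.
Qed.

Lemma flat_second_form p v w x y : flat M -> M p -> tangent M p v -> tangent M p w ->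
  tangent M p x -> tangent M p y ->
  dot (II p v w) (II p x y) = dot (II p x w) (II p v y).
Proof.
move=> flatM Mp Tv Tw Tx Ty.
have [V [TV Vp]] := tangent_field_extend surfM Mp Tv.
have [W [TW Wp]] := tangent_field_extend surfM Mp Tw.
have [X [TX Xp]] := tangent_field_extend surfM Mp Tx.
rewrite -Vp -Wp -Xp; apply: subr0_eq.
apply: etrans (esym (gauss_equation TX TV TW Mp Ty)) _.
by rewrite flatM// dot0l.
Qed.

Lemma second_form_flat :
  (forall (p v w x y : E4), M p -> tangent M p v -> tangent M p w -> tangent M p x ->
     tangent M p y -> dot (II p v w) (II p x y) = dot (II p x w) (II p v y)) ->
  flat M.
Proof.
move=> sym X Y Z TX TY TZ p Mp.
have Tn A B : tangent M p (nablaT M A B p) by exact: tanpart_tangent.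
apply: (tangent_eq surfM Mp) => //; first by apply: tangentB => //; apply: tangentB.
  exact: tangent0.
move=> w Tw; rewrite dot0l; apply: etrans (gauss_equation TX TY TZ Mp Tw) _.
have h := sym p _ _ _ _ Mp (TY.2 p Mp) (TZ.2 p Mp) (TX.2 p Mp) Tw.
exact: etrans (congr2 (fun a b => a - b) h (erefl _)) (subrr _).
Qed.

End Extrinsic.

(** Polarization: [2 b(u, v) = b(u + v, u + v) - b(u, u) - b(v, v)]. It is needed because the
    curvature ellipse records the second form only on the diagonal. *)
Lemma polarization_line (S : 'rV[R]_4 -> Prop) (b : 'rV[R]_4 -> 'rV[R]_4 -> 'rV[R]_4) d :
  (forall u v, S u -> S v -> S (u + v)) ->
  (forall u v, S u -> S v -> b u v = b v u) ->
  (forall u v w, S u -> S v -> S w -> b (u + v) w = b u w + b v w) ->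
  (forall u, S u -> exists r, b u u = r *: d) ->
  forall u v, S u -> S v -> exists r, b u v = r *: d.
Proof.
move=> SD bC bD bd u v Su Sv; have Suv := SD _ _ Su Sv.
have [x xE] := bd _ Suv; have [y yE] := bd _ Su; have [z zE] := bd _ Sv.
exists (2^-1 * (x - y - z)).
have e : x *: d = y *: d + b u v + (b u v + z *: d).
  by rewrite -xE -yE -zE bD// (bC u (u + v))// (bC v (u + v))// !bD// (bC v u).
rewrite -scalerA 2!scalerBl e.
have -> : y *: d + b u v + (b u v + z *: d) - y *: d - z *: d = (2 : R) *: b u v.
  by apply/rowP => i; rewrite !mxE; ring.
by rewrite scalerA mulVf ?scale1r// pnatr_eq0.
Qed.

(** * Pointwise algebra of shape operators *)

Section ShapeAlgebra.
Local Notation E4 := 'rV[R]_4.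
Variables (T N : E4 -> Prop) (II : E4 -> E4 -> E4) (c : E4).
Variables (x1 x2 n1 n2 : E4).
Hypotheses (frT : plane_frame T x1 x2) (frN : plane_frame N n1 n2) (Nc : N c).
Hypothesis NB : forall a u v, N u -> N v -> N (u + a *: v).
Hypothesis IIN : forall u v, N (II u v).
Hypothesis IIC : forall u v, T u -> T v -> II u v = II v u.
Hypothesis IIZD : forall a u v w, II (a *: u + v) w = a *: II u w + II v w.
Hypothesis cII : forall u v, T u -> T v -> dot c (II u v) = dot u v.

Let Tx1 : T x1. Proof. by apply/(proj1 frT); exists 1, 0; rewrite scale1r scale0r addr0. Qed.
Let Tx2 : T x2. Proof. by apply/(proj1 frT); exists 0, 1; rewrite scale1r scale0r add0r. Qed.

Lemma metric_vector_neq0 : c != 0.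
Proof.
apply/negP => /eqP c0; have := cII Tx1 Tx1.
rewrite c0 dot0l => /esym/eqP; rewrite dot_eq0 => /eqP x10.
have [/eqP] : (1 : R) = 0 /\ (0 : R) = 0.
  by apply: (proj2 frT); rewrite x10 scaler0 scale0r addr0.
by rewrite oner_eq0.
Qed.

(* [A w] is the shape operator of [w]. Since [A c] is the identity and [N] is a plane,
   all shape operators commute. *)
Lemma shape_operators_commute (A : E4 -> E4 -> E4) :
  (forall w u, N w -> T u -> T (A w u)) ->
  (forall w u v, N w -> T u -> T v -> dot (A w u) v = dot w (II u v)) ->
  forall w y u v, N w -> N y -> T u -> T v ->
  dot (A w u) (A y v) = dot (A w v) (A y u).
Proof.
move=> TA AE; have c0 := metric_vector_neq0.
have cc0 : dot c c != 0 by rewrite dot_eq0.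
have [d [Nd d0 cd dP]] := plane_frame_ortho_line frN Nc c0.
have decomp w : N w -> exists a b, w = a *: c + b *: d.
  move=> Nw; have [||s sE] := dP (w + (- (dot c w / dot c c)) *: c).
  - exact: NB.
  - by rewrite dotDr dotZr mulNr divfK// subrr.
  exists (dot c w / dot c c), s; rewrite -sE.
  by rewrite addrCA scaleNr subrr addr0.
(* For [w = a c + b d] the [c] part is automatically symmetric, because [c] pairs with [II] to the
   inner product and [A y] is self-adjoint. Only [w = d] has to be assumed. *)
have reduce y u v : N y -> T u -> T v ->
    (forall u v, T u -> T v -> dot d (II u (A y v)) = dot d (II v (A y u))) ->
    forall w, N w -> dot (A w u) (A y v) = dot (A w v) (A y u).
  move=> Ny Tu Tv yd w Nw; have [Tyu Tyv] : T (A y u) /\ T (A y v) by split; exact: TA.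
  rewrite !AE//; have [a [b ->]] := decomp w Nw.
  rewrite !dotDl !dotZl !cII// (yd u v Tu Tv) (dotC u) (dotC v) !AE//.
  by rewrite (IIC Tu Tv).
(* The reduction is used twice: it replaces [w] by [d] and then, after exchanging the factors, [y]
   by [d]. With [d] in both places the claim is symmetry of the inner product. *)
move=> w y u v Nw Ny Tu Tv; apply: (reduce) => // u' v' Tu' Tv'.
have [Tyu Tyv] : T (A y u') /\ T (A y v') by split; exact: TA.
rewrite -!AE// (dotC (A d u')) (dotC (A d v')).
apply: (reduce) => // u2 v2 Tu2 Tv2.
have [Tdu Tdv] : T (A d u2) /\ T (A d v2) by split; exact: TA.
by rewrite -!AE// dotC.
Qed.

Hypothesis gauss : forall u v w z, T u -> T v -> T w -> T z ->
  dot (II u v) (II w z) = dot (II w v) (II u z).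

Lemma second_form_zero w : II 0 w = 0.
Proof. by have := IIZD (-1) 0 0 w; rewrite scaler0 addr0 scaleN1r addNr. Qed.

(* By [gauss], the shape operator of a normal [d] orthogonal to [c] is injective. *)
Lemma second_form_nondegenerate d v : N d -> d != 0 -> dot c d = 0 -> T v ->
  (forall w, T w -> dot d (II v w) = 0) -> v = 0.
Proof.
move=> Nd d0 cd Tv dv; apply/eqP; apply: contrapT => /negP v0.
have c0 := metric_vector_neq0.
have cc0 : dot c c != 0 by rewrite dot_eq0.
have [d' [Nd' d'0 cd' dP]] := plane_frame_ortho_line frN Nc c0.
have [r dE] := dP d Nd cd.
have r0 : r != 0 by apply: contra d0 => /eqP r0; rewrite dE r0 scale0r.
(* Being orthogonal to [d], the vector [II v w] is a multiple of [c], and its product with [c] fixes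
   the coefficient. *)
have IIv w : T w -> II v w = (dot v w / dot c c) *: c.
  move=> Tw; apply: subr0_eq.
  have [||s sE] := dP (II v w - (dot v w / dot c c) *: c).
  - by rewrite -scaleNr; exact: NB.
  - by rewrite dotBr dotZr cII// divfK// subrr.
  have : dot d (s *: d') = 0.
    by rewrite -sE dotBr dotZr dv// (dotC d) cd mulr0 subrr.
  rewrite dE dotZl dotZr sE => /eqP.
  rewrite !mulf_eq0 dot_eq0 (negbTE d'0) (negbTE r0) orbF => /eqP ->.
  by rewrite scale0r.
(* With [u] orthogonal to [v] one has [II v u = 0], so [gauss] forces [|v|^2 |u|^2 / |c|^2 = 0]. *)
have [u [Tu u0 vu _]] := plane_frame_ortho_line frT Tv v0.
have := gauss Tv Tv Tu Tu.
rewrite (IIC Tu Tv) (IIv v Tv) (IIv u Tu) vu mul0r scale0r dot0r dotZl.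
rewrite cII// => /eqP; rewrite !mulf_eq0 invr_eq0 !dot_eq0.
by rewrite (negbTE v0) (negbTE u0) (negbTE c0).
Qed.

Variables (nd : E4 -> E4) (g : E4).
Hypothesis Tg : T g.
Hypothesis ndN : forall u, N (nd u).
Hypothesis ndZD : forall a u v, nd (a *: u + v) = a *: nd u + nd v.
Hypothesis ndII : forall u v w, T u -> T v -> T w ->
  dot (nd u) (II v w) = dot (nd v) (II u w).
Hypothesis gE : forall w, T w -> dot g w = dot c (nd w).

(* If [nd u - II(u, g)] were not zero, it would be proportional to a fixed normal
   direction orthogonal to [c] whose shape operator is not injective. *)
Lemma second_form_gradient_plane u : T u -> II u g = nd u.
Proof.
move=> Tu; pose m v := nd v - II v g.
have mN v : N (m v) by rewrite /m -scaleN1r; exact: NB.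
have mc v : T v -> dot c (m v) = 0.
  by move=> Tv; rewrite /m dotBr -gE// cII// (dotC v) subrr.
have msym v w z : T v -> T w -> T z -> dot (m v) (II w z) = dot (m w) (II v z).
  by move=> Tv Tw Tz; rewrite /m !dotBl ndII// gauss.
have mZD a' v w : m (a' *: v + w) = a' *: m v + m w.
  by rewrite /m ndZD IIZD scalerBr opprD addrACA.
suff [m1 m2] : m x1 = 0 /\ m x2 = 0.
  have [a [b uE]] := (proj1 frT u).1 Tu; apply/esym/subr0_eq.
  have m0 : m 0 = 0 by have := mZD (-1) 0 0; rewrite scaler0 addr0 scaleN1r addNr.
  by rewrite -/(m u) uE mZD -[b *: x2]addr0 mZD m0 m1 m2 !scaler0 !addr0.
have [d [Nd d0 cd dP]] := plane_frame_ortho_line frN Nc metric_vector_neq0.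
have [l1 l1E] := dP _ (mN x1) (mc x1 Tx1); have [l2 l2E] := dP _ (mN x2) (mc x2 Tx2).
(* As [m x1 = l1 *: d] and [m x2 = l2 *: d], the symmetry [msym] says exactly that this combination
   is killed by the shape operator of [d]. *)
have v0 : l2 *: x1 + (- l1) *: x2 = 0.
  apply: (second_form_nondegenerate Nd d0 cd).
    by apply/(proj1 frT); do 2 eexists.
  move=> w Tw; have := msym x1 x2 w Tx1 Tx2 Tw; rewrite l1E l2E !dotZl => e.
  rewrite IIZD -[(- l1) *: x2]addr0 IIZD second_form_zero.
  by rewrite addr0 dotDr !dotZr mulNr e subrr.
have [l20 /eqP] := proj2 frT _ _ v0; rewrite oppr_eq0 => /eqP l10.
by rewrite l1E l2E l10 l20 !scale0r.
Qed.

End ShapeAlgebra.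

(** * The metric section and the gradient of its squared length *)

Section MetricSection.
Local Notation E4 := 'rV[R]_4.
Variables (M : set E4) (c : E4 -> E4).
Hypotheses (surfM : is_surface M) (metric_c : metric_section M c).
Local Notation II := (second_form M).
Local Notation T := (tangent M).
Local Notation N := (normal M).

Lemma metric_section_second_form p u w : M p -> T p u -> T p w ->
  dot (c p) (II p u w) = dot u w.
Proof.
move=> Mp Tu Tw; have [X [TX <-]] := tangent_field_extend surfM Mp Tu.
have [Y [TY <-]] := tangent_field_extend surfM Mp Tw.
apply: etrans (congr1 (dot (c p)) (esym (alphaE surfM TX TY Mp))) _.
exact: metric_c.2.
Qed.

Lemma tanpart_Dd_metric_section p u : M p -> T p u -> tanpart M p (Dd M c p u) = - u.
Proof.
move=> Mp Tu; apply: (tangent_eq surfM Mp); first exact: tanpart_tangent.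
  exact: tangentN.
move=> w Tw; apply: etrans (dot_tanpart surfM Mp _ Tw) _.
apply: etrans (dot_Dd_normal surfM metric_c.1 Mp Tu Tw) _.
by rewrite metric_section_second_form// dotNl.
Qed.

Definition normal_derivative p u := norpart M p (Dd M c p u).
Local Notation nd := normal_derivative.

Lemma normal_derivative_normal p u : M p -> N p (nd p u).
Proof. by move=> Mp; exact: norpart_normal. Qed.

Lemma Dd_metric_section p u : M p -> T p u -> Dd M c p u = - u + nd p u.
Proof.
by move=> Mp Tu; rewrite -(tanpart_Dd_metric_section Mp Tu); exact: esym (tanpartDnor _ _ _).
Qed.

Lemma normal_derivativeZD p a u v : M p -> nd p (a *: u + v) = a *: nd p u + nd p v.
Proof.
move=> Mp; apply: etrans (congr1 (norpart M p) (Dd_linear a u v metric_c.1.1 Mp)) _.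
exact: norpartZD.
Qed.

(* Symmetry of the second derivatives of [c]. *)
Lemma normal_derivative_second_form p u v w : M p -> T p u -> T p v -> T p w ->
  dot (nd p u) (II p v w) = dot (nd p v) (II p u w).
Proof.
have aux (a b x y : R) : - (a - b) = (- a - x) - (- b - y) -> y = x by lra.
move=> Mp Tu Tv Tw.
have [U [TU Up]] := tangent_field_extend surfM Mp Tu.
have [V [TV Vp]] := tangent_field_extend surfM Mp Tv.
have sc := metric_c.1.1.
(* Differentiates [D_B c = - B + nd B] along [A]. In the commutator the terms [- B] give minus the
   bracket, which is also the tangential part of the derivative of [c] along it; only the [nd] terms
   survive. *)
have key A B : tangent_field M A -> tangent_field M B ->
    dot (Dd M (fun q => Dd M c q (B q)) p (A p)) w =
    - dot (Dd M B p (A p)) w - dot (nd p (B p)) (II p (A p) w).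
  move=> TA TB; have TAp := TA.2 p Mp.
  have sN : normal_section M (fun q => nd q (B q)).
    by apply: (normal_section_norpart surfM); exact: smooth_Dd.
  have e1 : Dd M (fun q => Dd M c q (B q)) p (A p) =
      Dd M (fun q => - B q + nd q (B q)) p (A p).
    apply: (eq_Dd Mp TAp); first exact: smooth_Dd.
    by move=> q Mq; apply: Dd_metric_section => //; exact: TB.2.
  have e2 := DdD Mp TAp (smoothN TB.1) sN.1.
  have e3 := DdN Mp TAp TB.1.
  apply: etrans (congr1 (fun z : E4 => dot z w) (etrans e1 e2)) _.
  apply: etrans (dotDl _ _ _) _.
  apply: (congr2 +%R); last exact: (dot_Dd_normal surfM sN Mp TAp Tw).
  apply: etrans (congr1 (fun z : E4 => dot z w) e3) _; exact: dotNl.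
have Tb := bracket_tangent surfM TU TV Mp.
have comm := Dd_Dd_comm Mp (xget_smooth_extension sc Mp) TU TV.
have hb : dot (Dd M c p (bracket M U V p)) w = - dot (bracket M U V p) w.
  apply: etrans (esym (dot_tanpart surfM Mp _ Tw)) _.
  by rewrite tanpart_Dd_metric_section// dotNl.
have h1 := etrans hb (congr1 (@GRing.opp R) (dotBl _ _ _)).
have h2 := etrans (congr1 (fun z : E4 => dot z w) (esym comm)) (dotBl _ _ _).
have h3 := congr2 (fun a b => a - b) (key U V TU TV) (key V U TV TU).
by rewrite -Up -Vp; exact: aux (etrans (esym h1) (etrans h2 h3)).
Qed.

Lemma metric_section_neq0 p : M p -> c p != 0.
Proof.
move=> Mp; have [x1 [x2 fr]] := tangent_frame surfM Mp.
apply: (metric_vector_neq0 fr) => u v; exact: metric_section_second_form.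
Qed.

Lemma second_form_gradient p g u : flat M -> M p -> T p g ->
  (forall w, T p w -> dot g w = dot (c p) (nd p w)) -> T p u ->
  II p u g = nd p u.
Proof.
move=> flatM Mp Tg gE Tu.
have [x1 [x2 frT]] := tangent_frame surfM Mp.
have [n1 [n2 frN]] := normal_frame surfM Mp.
apply: (second_form_gradient_plane (II := II p) (nd := nd p) frT frN
  (metric_c.1.2 p Mp) _ _ _ _ _ _ Tg _ _ _ gE Tu).
- by move=> a v w Nv Nw; apply: normalD => //; exact: normalZ.
- by move=> v w; exact: second_form_normal.
- by move=> v w; exact: second_formC.
- by move=> a v w z; exact: second_formZDl.
- by move=> v w; exact: metric_section_second_form.
- by move=> v w x y Tv Tw Tx Ty; exact: flat_second_form.
- by move=> v; exact: normal_derivative_normal.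
- by move=> a v w; exact: normal_derivativeZD.
- by move=> v w x; exact: normal_derivative_second_form.
Qed.

(** [grad] is a choice, so a witness is required: the tangential part of the ambient gradient of a
    local extension. *)
Lemma gradP (f : E4 -> R) p : smooth M f -> M p ->
  T p (grad M f p) /\ forall w, T p w -> dot (grad M f p) w = Dd M f p w.
Proof.
move=> sf Mp; pose L : {linear E4 -> R^o} := 'd (xget f [set g | smooth_extension M f p g]) p.
have DL w : Dd M f p w = L w.
  rewrite /Dd deriveE//.
  exact: smooth_extension_differentiable (xget_smooth_extension sf Mp).
pose g : E4 := \row_i L (delta_mx 0 i).
apply: (@xgetPex _ 0 [set v | T p v /\ forall w, T p w -> dot v w = Dd M f p w]).
exists (tanpart M p g); split; first exact: tanpart_tangent.
move=> w Tw; rewrite DL dot_tanpart// dotE {2}[w]row_sum_delta linear_sum.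
by apply: eq_bigr => i _; rewrite linearZ mxE mulrC.
Qed.

Lemma dot_half_grad p w : M p -> T p w ->
  dot (2^-1 *: grad M (fun q => dot (c q) (c q)) p) w = dot (c p) (nd p w).
Proof.
move=> Mp Tw; have sc := metric_c.1.1.
rewrite dotZl (gradP (smooth_dot sc sc) Mp).2// Dd_dot//.
rewrite Dd_metric_section// [dot (_ + _) (c p)]dotC dotDr dotNr.
rewrite (metric_c.1.2 p Mp w Tw) oppr0 add0r.
by move: (dot (c p) _) => x; field.
Qed.

End MetricSection.

(** * The transformed surface *)

(** Charts are transported as [F \o x] with inverse [y \o G]; the open domains are cut out with a
    local extension of [G], since [G] itself is controlled only on [N]. *)
Lemma diffeomorphism_surface (M N : set 'rV[R]_4) (F G : 'rV[R]_4 -> 'rV[R]_4) :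
  is_surface M -> diffeomorphism M N F G -> is_surface N.
Proof.
move=> surfM [sF sG FN GM] q Nq; have [MGq FGq] := GM q Nq.
have [W [U [x [y [[oW WGq oU] [sx sy xMW yx]]]]]] := surfM _ MGq.
have [g [D [oD Dq sg gG]]] := sG q Nq.
have xM a : U a -> M (x a) by move=> /xMW[[]].
have sFx : smooth_on U (F \o x) by exact: smooth_on_comp_smooth sx sF.
have oW' : open (D `&` g @^-1` W).
  by apply: (open_preimage_on _ oD oW) => z; exact: smooth_on_continuous sg.
have oU' : open (U `&` (F \o x) @^-1` D).
  by apply: (open_preimage_on _ oU oD) => a; exact: smooth_on_continuous sFx.
exists (D `&` g @^-1` W), (U `&` (F \o x) @^-1` D), (F \o x), (y \o G).
split; split=> //.
- by split=> //=; rewrite gG.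
- by apply: smooth_on_subset sFx => a [].
- apply: (@smooth_comp _ _ _ _ (M `&` W)) sy.
    by move=> z [Nz [Dz Wz]]; split; [have [] := GM z Nz|rewrite -gG].
  by apply: smooth_subset sG => z [].
- move=> a [Ua Da]; have [[Mxa Wxa] yxa] := xMW a Ua; have [NFx GFx] := FN _ Mxa.
  by split=> /=; [split=> //; split=> //=; rewrite gG// GFx|rewrite GFx].
- move=> z [Nz [Dz Wz]]; have [MGz FGz] := GM z Nz.
  have WGz : W (G z) by rewrite -gG.
  have [UyG xyG] := yx _ (conj MGz WGz).
  by split=> /=; [split=> //=; rewrite xyG FGz|rewrite xyG FGz].
Qed.

Section Transformation.
Local Notation E4 := 'rV[R]_4.
Variables (M : set E4) (c e k : E4 -> E4) (t : R) (G : E4 -> E4).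
Local Notation F := (transf t c e).
Local Notation M1 := (F @` M).
Hypotheses (surfM : is_surface M) (flatM : flat M) (metric_c : metric_section M c).
Hypotheses (radial_e : radial_field M e) (normal_k : normal_section M k).
Hypothesis ek : forall X, tangent_field M X -> forall p, M p ->
  norpart M p (Dd M (fun q => e q - k q) p (X p)) = 0.
Hypothesis dif : diffeomorphism M M1 F G.
Local Notation II := (second_form M).
Local Notation nd := (normal_derivative M c).
Local Notation T := (tangent M).
Local Notation N := (normal M).

Lemma radial_field_Dd p u : M p -> T p u -> Dd M e p u = u + II p u (e p).
Proof.
move=> Mp Tu; have [X [TX Xp]] := tangent_field_extend surfM Mp Tu.
apply: etrans (esym (tanpartDnor M p _)) _; apply: (congr2 +%R).
  by rewrite -Xp; exact: radial_e.2.
by rewrite -Xp; exact: (alphaE surfM TX radial_e.1 Mp).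
Qed.

Lemma norpart_Dd_k p u : M p -> T p u -> norpart M p (Dd M k p u) = II p u (e p).
Proof.
move=> Mp Tu; have [X [TX Xp]] := tangent_field_extend surfM Mp Tu.
have h := ek TX Mp; have TXp := TX.2 p Mp.
have h1 := etrans (congr1 (norpart M p) (esym (DdB Mp TXp radial_e.1.1 normal_k.1))) h.
have h2 := subr0_eq (etrans (esym (norpartB surfM Mp _ _)) h1).
rewrite -Xp; apply: etrans (esym h2) _.
exact: (alphaE surfM TX radial_e.1 Mp).
Qed.

Definition image_differential p u : E4 := t *: nd p u - (1 - t) *: II p u (e p).
Local Notation B := image_differential.

Lemma image_differential_normal p u : M p -> N p (B p u).
Proof.
move=> Mp; apply: normalB; apply: normalZ; last exact: second_form_normal.
exact: normal_derivative_normal.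
Qed.

(** The weights in [transf] are such that the tangential terms cancel: [u - t u - (1 - t) u = 0]. *)
Lemma Dd_transf p u : M p -> T p u -> Dd M F p u = B p u.
Proof.
move=> Mp Tu; have sc := metric_c.1.1; have se := radial_e.1.1.
have s1 : smooth M (fun q => q + t *: c q).
  by apply: smoothD; [exact: smooth_id|exact: smoothZ].
apply: etrans (DdB Mp Tu s1 (smoothZ (1 - t) se)) _.
apply: etrans (congr2 (fun a b : E4 => a - b)
  (DdD Mp Tu (@smooth_id _ M) (smoothZ t sc)) (DdZ Mp Tu (1 - t) se)) _.
apply: etrans (congr2 (fun a b : E4 => a - b)
  (congr2 (fun a b : E4 => a + b) (Dd_id Tu) (DdZ Mp Tu t sc)) (erefl _)) _.
apply: etrans (congr2 (fun a b : E4 => u + t *: a - (1 - t) *: b)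
  (Dd_metric_section surfM metric_c Mp Tu) (radial_field_Dd Mp Tu)) _.
rewrite /B; move: (nd p u) (II p u (e p)) => x y.
by apply/rowP => i; rewrite !mxE; ring.
Qed.

Let FM q : M q -> M1 (F q). Proof. by move=> Mq; exists q. Qed.
Let sF : smooth M F. Proof. by case: dif. Qed.

Lemma transf_surface : is_surface M1.
Proof. exact: diffeomorphism_surface surfM dif. Qed.

(** Pull [w] back by the differential of [G] and apply the chain rule to [F \o G], the identity on
    the image. *)
Lemma tangent_transf_ex p w : M p -> tangent M1 (F p) w ->
  exists2 u, T p u & w = B p u.
Proof.
move=> Mp Tw; have [_ sG FN GM] := dif.
have GFp : G (F p) = p by have [] := FN p Mp.
have Tu := Dd_tangent sG (FM Mp) (fun q Nq => (GM q Nq).1) Tw.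
rewrite GFp in Tu; exists (Dd M1 G (F p) w) => //.
rewrite -(Dd_transf Mp Tu).
have h := Dd_comp (FM Mp) Tw sG (fun q Nq => (GM q Nq).1) sF.
rewrite GFp in h; apply: etrans _ h; apply/esym.
apply: etrans _ (Dd_id Tw); apply/esym.
apply: (eq_Dd (FM Mp) Tw); first exact: smooth_id.
by move=> q /GM[_ /esym].

Qed.

Lemma tangent_transf p u : M p -> T p u -> tangent M1 (F p) (B p u).
Proof.
by move=> Mp Tu; rewrite -(Dd_transf Mp Tu); exact: (Dd_tangent sF Mp FM Tu).
Qed.

(** One inclusion is the normality of [B p u]. The other is a dimension count, both sides being
    planes because the image is a surface. *)
Lemma tangent_transfE p w : M p -> tangent M1 (F p) w <-> N p w.
Proof.
move=> Mp; have sub w' : tangent M1 (F p) w' -> N p w'.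
  by move=> /(tangent_transf_ex Mp)[u Tu ->]; exact: image_differential_normal.
split; first exact: sub.
have [x1 [x2 frT]] := tangent_frame transf_surface (FM Mp).
have [n1 [n2 frN]] := normal_frame surfM Mp.
exact: (plane_frame_subset frT frN sub).
Qed.

Lemma normal_transfE p w : M p -> normal M1 (F p) w <-> T p w.
Proof.
move=> Mp; split=> [Nw|Tw v /(tangent_transfE v Mp) Nv]; last by rewrite dotC Nv.
by apply: (normal_normal_tangent surfM Mp) => n Nn; apply: Nw; apply/(tangent_transfE n Mp).
Qed.

Lemma tanpart_transf p w : M p -> tanpart M1 (F p) w = norpart M p w.
Proof.
move=> Mp; apply: (tanpart_eq transf_surface (FM Mp)).
  by apply/(tangent_transfE _ Mp); exact: norpart_normal.
apply/(normal_transfE _ Mp); rewrite -{1}(tanpartDnor M p w) addrK.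
exact: tanpart_tangent.
Qed.

Lemma norpart_transf p w : M p -> norpart M1 (F p) w = tanpart M p w.
Proof.
move=> Mp; rewrite -[RHS](addrK (norpart M p w)) tanpartDnor -(tanpart_transf _ Mp).
by rewrite -{2}(tanpartDnor M1 (F p) w) addrAC subrr add0r.
Qed.

Lemma Dd_transf_comp p u (f : E4 -> E4) : smooth M1 f -> M p -> T p u ->
  Dd M1 f (F p) (B p u) = Dd M (f \o F) p u.
Proof.
move=> sf Mp Tu; rewrite -(Dd_transf Mp Tu); apply/esym.
exact: (Dd_comp Mp Tu sF FM sf).
Qed.

Lemma normal_section_transf (Y : E4 -> E4) : tangent_field M1 Y -> normal_section M (Y \o F).
Proof.
move=> [sY TY]; split; first exact: (smooth_comp FM sF sY).
by move=> p Mp; apply/(tangent_transfE _ Mp); exact/TY/FM.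
Qed.

(** A tangent field [Y] of the image gives a normal section [Y \o F] of [M], and normal parts on the
    image are tangential parts on [M]. The Weingarten equation thus identifies the new second form
    with minus the old shape operator. *)
Lemma dot_second_form_transf p u w v : M p -> T p u -> N p w -> T p v ->
  dot (second_form M1 (F p) (B p u) w) v = - dot w (II p u v).
Proof.
move=> Mp Tu Nw Tv; have surf1 := transf_surface; have M1p := FM Mp.
have [Y [TY Yp]] := tangent_field_extend surf1 M1p ((tangent_transfE w Mp).2 Nw).
have [X [TX Xp]] := tangent_field_extend surf1 M1p (tangent_transf Mp Tu).
have e1 : second_form M1 (F p) (B p u) w = tanpart M p (Dd M (Y \o F) p u).
  rewrite -Yp -Xp; apply: etrans (esym (alphaE surf1 TX TY M1p)) _.
  apply: etrans (norpart_transf _ Mp) _; rewrite Xp.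
  exact: (congr1 (tanpart M p) (Dd_transf_comp TY.1 Mp Tu)).
rewrite e1; apply: etrans (dot_tanpart surfM Mp _ Tv) _.
apply: etrans (dot_Dd_normal surfM (normal_section_transf TY) Mp Tu Tv) _.
by rewrite -Yp.
Qed.

Lemma metric_section_transf c1 j p : metric_section M1 c1 -> M p ->
  j = 2^-1 *: grad M (fun q => dot (c q) (c q)) p ->
  c1 (F p) = (1 - t) *: e p - t *: j.
Proof.
move=> metric_c1 Mp jE; have surf1 := transf_surface; have M1p := FM Mp.
have Tj : T p j.
  rewrite jE; apply: tangentZ => //.
  by apply: (gradP surfM _ Mp).1; apply: smooth_dot; exact: metric_c.1.1.
have Te : T p (e p) by exact: radial_e.1.2.
have Tc1 : T p (c1 (F p)) by apply/(normal_transfE _ Mp); exact: metric_c1.1.2.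
set c' := (1 - t) *: e p - t *: j.
have Tc' : T p c' by apply: tangentB => //; exact: tangentZ.
have IIj u : T p u -> II p u j = nd p u.
  move=> Tu; apply: (second_form_gradient surfM metric_c flatM Mp Tj _ Tu) => w Tw.
  by rewrite jE; exact: dot_half_grad.
have key u : T p u -> II p u (c1 (F p)) = II p u c'.
  move=> Tu; apply: normal_eq; [exact: second_form_normal|exact: second_form_normal|].
  move=> w Nw; apply: oppr_inj.
  apply: etrans (congr1 (@GRing.opp R) (dotC _ _)) _.
  apply: etrans (esym (dot_second_form_transf Mp Tu Nw Tc1)) _.
  apply: etrans (dotC _ _) _.
  have h := metric_section_second_form surf1 metric_c1 M1p (tangent_transf Mp Tu)
    ((tangent_transfE w Mp).2 Nw).
  apply: etrans h _.
  have IIc' : II p u c' = - B p u.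
    rewrite /c' -scaleNr; have Ttj := tangentZ surfM Mp (- t) Tj.
    apply: etrans (second_formZDr surfM (1 - t) Mp Te Ttj Tu) _.
    apply: etrans (congr1 (fun z : E4 => (1 - t) *: II p u (e p) + z)
      (etrans (second_formZr surfM (- t) Mp Tj Tu) (congr1 _ (IIj u Tu)))) _.
    by rewrite /B opprB scaleNr.
  apply: etrans _ (congr1 (fun z : E4 => - dot z w) (esym IIc')).
  by rewrite dotNl opprK.
(* Pairing with [c p] turns equality of the values of [II] into equality of inner products, so a
   tangent vector is determined by its values under [II]. *)
apply: (tangent_eq surfM Mp) => // w Tw.
have h1 := metric_section_second_form surfM metric_c Mp Tw Tc1.
have h2 := metric_section_second_form surfM metric_c Mp Tw Tc'.
apply: etrans (dotC _ _) _; apply: etrans _ (dotC _ _).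
by apply: etrans (esym h1) _; apply: etrans _ h2; rewrite key.
Qed.

Definition transf_radial q : E4 := t *: c q - (1 - t) *: k q.
Local Notation s := transf_radial.

Lemma smooth_transf_radial : smooth M s.
Proof. by apply: smoothB; apply: smoothZ; [exact: metric_c.1.1|exact: normal_k.1]. Qed.

Lemma norpart_Dd_transf_radial p u : M p -> T p u -> norpart M p (Dd M s p u) = B p u.
Proof.
move=> Mp Tu; have sc := metric_c.1.1; have sk := normal_k.1.
have e1 := DdB Mp Tu (smoothZ t sc) (smoothZ (1 - t) sk).
have e2 := congr2 (fun a b : E4 => a - b) (DdZ Mp Tu t sc) (DdZ Mp Tu (1 - t) sk).
apply: etrans (congr1 (norpart M p) (etrans e1 e2)) _.
apply: etrans (norpartB surfM Mp _ _) _.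
apply: (congr2 (fun a b : E4 => a - b)); first exact: norpartZ.
apply: etrans (norpartZ surfM Mp _ _) _.
exact: congr1 (norpart_Dd_k Mp Tu).
Qed.

Lemma transf_GF p : M p -> G (F p) = p.
Proof. by case: dif => _ _ FN _ /FN[]. Qed.

Lemma radial_field_transf : radial_field M1 (s \o G).
Proof.
have [_ sG FN GM] := dif.
have ss : smooth M1 (s \o G) 
  by exact: (smooth_comp (fun q Nq => (GM q Nq).1) sG smooth_transf_radial).
split; first split=> // q [p Mp <-].
  rewrite /= transf_GF//; apply/(tangent_transfE _ Mp).
  by apply: normalB; apply: normalZ; [exact: metric_c.1.2|exact: normal_k.2].
move=> X TX q [p Mp <-].
have [u Tu XE] := tangent_transf_ex Mp (TX.2 _ (FM Mp)).
rewrite /nablaT XE; apply: etrans (tanpart_transf _ Mp) _.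
apply: etrans (congr1 (norpart M p) (Dd_transf_comp ss Mp Tu)) _.
apply: etrans _ (norpart_Dd_transf_radial Mp Tu); apply: congr1; apply/esym.
apply: (eq_Dd Mp Tu); first exact: smooth_transf_radial.
by move=> z Mz; rewrite /= transf_GF.
Qed.

Lemma transf_transf c1 j t' p : metric_section M1 c1 -> M p ->
  j = 2^-1 *: grad M (fun q => dot (c q) (c q)) p ->
  transf t' c1 (s \o G) (F p) =
  p + (t * t') *: (c p - j) - ((1 - t) * (1 - t')) *: (e p - k p).
Proof.
move=> metric_c1 Mp jE.
rewrite /transf /= (transf_GF Mp) (metric_section_transf metric_c1 Mp jE) /s.
(* The coefficient of [c p] is [t - (1 - t') t = t t']; that of [e p] is [- (1 - t) + t' (1 - t) = -
   (1 - t) (1 - t')]. *)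
by apply/rowP => i; rewrite !mxE; ring.
Qed.

(** The normal parts of the derivatives of [s] and [e1 \o F] are both [B p u]: a radial field on the
    image has its own direction as tangential derivative, and tangential there means normal to
    [M]. *)
Lemma parallel_transf e1 a : radial_field M1 e1 ->
  parallel_section M (fun p => a *: (s p - e1 (F p))).
Proof.
move=> rad1; have Ne1 := normal_section_transf rad1.1.
have sa : smooth M (fun p => s p - (e1 \o F) p).
  by apply: smoothB; [exact: smooth_transf_radial|exact: Ne1.1].
split; first split.
- exact: smoothZ.
- move=> p Mp; apply: normalZ; apply: normalB; last exact: Ne1.2.
  by apply: normalB; apply: normalZ; [exact: metric_c.1.2|exact: normal_k.2].
move=> X TX p Mp; have Tu := TX.2 p Mp; rewrite /nablaN.
apply: etrans (congr1 (norpart M p) (DdZ Mp Tu a sa)) _.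
apply: etrans (norpartZ surfM Mp _ _) _.
apply: etrans (congr1 (fun z : E4 => a *: norpart M p z)
  (DdB Mp Tu smooth_transf_radial Ne1.1)) _.
apply: etrans (congr1 (fun z : E4 => a *: z) (norpartB surfM Mp _ _)) _.
have e1E : norpart M p (Dd M (e1 \o F) p (X p)) = B p (X p).
  have surf1 := transf_surface; have M1p := FM Mp.
  have [X1 [TX1 X1p]] := tangent_field_extend surf1 M1p (tangent_transf Mp Tu).
  apply: etrans (congr1 (norpart M p) (esym (Dd_transf_comp rad1.1.1 Mp Tu))) _.
  apply: etrans (esym (tanpart_transf _ Mp)) _.
  by rewrite -X1p; exact: rad1.2.
apply: etrans (congr1 (fun z : E4 => a *: z)
  (congr2 (fun x y : E4 => x - y) (norpart_Dd_transf_radial Mp Tu) e1E)) _.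
by rewrite subrr scaler0.
Qed.

Lemma tangent_second_form_transf p v w : M p -> T p (second_form M1 (F p) v w).
Proof.
by move=> Mp; apply/(normal_transfE _ Mp); exact: (second_form_normal transf_surface _ _ (FM Mp)).
Qed.

Lemma flat_transf : flat M1.
Proof.
apply: (second_form_flat transf_surface) => q v w x y [p Mp <-].
move=> /(tangent_transf_ex Mp)[u Tu ->] /(tangent_transfE _ Mp) Nw.
move=> /(tangent_transf_ex Mp)[u' Tu' ->] /(tangent_transfE _ Mp) Ny.
have [x1 [x2 frT]] := tangent_frame surfM Mp.
have [n1 [n2 frN]] := normal_frame surfM Mp.
(* This is the shape operator of [M] at [w]. In these terms the Gauss condition on the image is the
   commutation of shape operators, the signs cancelling in pairs. *)
pose A w u := - second_form M1 (F p) (B p u) w.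
suff : dot (A w u) (A y u') = dot (A w u') (A y u).
  rewrite /A [LHS]dotNl [RHS]dotNl.
  by move=> /oppr_inj; rewrite [LHS]dotNr [RHS]dotNr => /oppr_inj.
apply: (shape_operators_commute (II := II p) frT frN (metric_c.1.2 p Mp)) Nw Ny Tu Tu'.
- by move=> a z z' Nz Nz'; apply: normalD => //; exact: normalZ.
- by move=> z z'; exact: second_formC.
- by move=> z z'; exact: metric_section_second_form.
- by move=> z z' Nz Tz; apply: tangentN => //; exact: tangent_second_form_transf.
- move=> z z' z'' Nz Tz Tz'; apply: etrans (dotNl _ _) _.
  apply: etrans (congr1 _ (dot_second_form_transf Mp Tz Nz Tz')) _.
  exact: opprK.
Qed.

(** If the ellipse lay on the line of [d], polarization would place every value of the new second
    form there. But its value at [B p u] and [c p] is [- u], and [u] can be taken nonzero, tangent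
    to [M] and orthogonal to [d]. *)
Lemma inflection_free_transf p : M p -> ~ inflection_point M1 (F p).
Proof.
move=> Mp [d [/(normal_transfE _ Mp) Td d0 ell]].
have surf1 := transf_surface; have M1p := FM Mp.
set II1 := second_form M1 (F p).
have II1d w : tangent M1 (F p) w -> exists r, II1 w w = r *: d.
  move=> Tw; have [->|w0] := eqVneq w 0.
    exists 0; rewrite scale0r -[X in II1 X _](scale0r (0 : E4)).
    by apply: etrans (second_formZl surf1 0 0 0 M1p) _; rewrite scale0r.
  have [X [TX Xp]] := tangent_field_extend surf1 M1p Tw.
  have [|s _ sE] := ell ((dot (X (F p)) (X (F p)))^-1 *: alpha M1 X X (F p)).
    by exists X; split=> //; rewrite Xp.
  exists (dot w w * s); rewrite -scalerA sE Xp scalerA mulfV ?dot_eq0// scale1r.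
  by have h := alphaE surf1 TX TX M1p; rewrite Xp in h; exact: esym h.
have II1c u : T p u -> II1 (B p u) (c p) = - u.
  move=> Tu; have Nc := metric_c.1.2 p Mp.
  apply: (tangent_eq surfM Mp); [exact: tangent_second_form_transf|exact: tangentN|].
  move=> v Tv; apply: etrans (dot_second_form_transf Mp Tu Nc Tv) _.
  by rewrite (metric_section_second_form surfM metric_c Mp Tu Tv) dotNl.
have [x1 [x2 frT]] := tangent_frame surfM Mp.
have [u [Tu u0 du _]] := plane_frame_ortho_line frT Td d0.
have [r rE] : exists r, II1 (B p u) (c p) = r *: d.
  apply: (polarization_line (S := tangent M1 (F p)) (b := II1)) II1d _ _ _ _.
  - by move=> v w; exact: tangentD.
  - by move=> v w; exact: second_formC.
  - move=> v w z _ _ _; have := second_formZDl surf1 1 v w z M1p.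
    by rewrite !scale1r.
  - exact: tangent_transf.
  - by apply/(tangent_transfE _ Mp); exact: metric_c.1.2.
have uE := etrans (esym (II1c u Tu)) rE.
have : dot d (- u) = 0 by rewrite dotNr du oppr0.
rewrite uE dotZr => /eqP; rewrite mulf_eq0 dot_eq0 (negbTE d0) orbF => /eqP r0.
by move: u0; rewrite -oppr_eq0 uE r0 scale0r eqxx.
Qed.

(** The defining property of [c1] puts the ellipse on the affine line of normals whose product with
    [c1 (F p)] is 1; its point nearest the origin is [c1 (F p)] divided by its squared length. *)
Lemma semiumbilic_transf c1 p : metric_section M1 c1 -> M p -> semiumbilic_point M1 (F p).
Proof.
move=> metric_c1 Mp; have surf1 := transf_surface; have M1p := FM Mp.
have c0 := metric_section_neq0 surf1 metric_c1 M1p.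
have Nc := metric_c1.1.2 _ M1p.
have [n1 [n2 frN]] := normal_frame surf1 M1p.
have [d [Nd d0 cd dP]] := plane_frame_ortho_line frN Nc c0.
set cp := c1 (F p) in c0 Nc cd dP *.
exists ((dot cp cp)^-1 *: cp), d; split=> //; first exact: normalZ.
move=> n [X [TX X0 ->]].
set Y := X (F p) in X0 *; set al := alpha M1 X X (F p).
have Nal : normal M1 (F p) al by exact: (normal_section_alpha surf1 TX TX.1).2.
have cal : dot cp al = dot Y Y by exact: metric_c1.2.
have [||s sE] := dP ((dot Y Y)^-1 *: al - (dot cp cp)^-1 *: cp).
- by apply: normalB; exact: normalZ.
- by rewrite dotBr !dotZr cal !mulVf ?dot_eq0// subrr.
by exists s => //; rewrite -sE addrC subrK.
Qed.

Lemma flat_semiumbilical_transf c1 : metric_section M1 c1 -> flat_semiumbilical_surface M1.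
Proof.
move=> metric_c1; split; [exact: transf_surface|exact: flat_transf|].
move=> q [p Mp <-]; split; first exact: semiumbilic_transf metric_c1 Mp.
exact: inflection_free_transf.
Qed.

End Transformation.

End Geometry.

Theorem mainTheorem17 (R : realType) (M : set 'rV[R]_4)
  (c j e k : 'rV[R]_4 -> 'rV[R]_4) (t1 t2 : R)
  (G1 G2 c1 c2 e1 e2 : 'rV[R]_4 -> 'rV[R]_4)
  (F1 := transf t1 c e) (F2 := transf t2 c e)
  (M1 := F1 @` M) (M2 := F2 @` M)
  (f21 := transf t2 c1 e1 \o F1) (f12 := transf t1 c2 e2 \o F2)
  (f := fun p : 'rV[R]_4 => p + (t1 * t2) *: (c p - j p)
                   - ((1 - t1) * (1 - t2)) *: (e p - k p))
  (e1' := fun q : 'rV[R]_4 => t1 *: c (G1 q) - (1 - t1) *: k (G1 q)) :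
  flat_semiumbilical_surface M ->
  metric_section M c ->
  (forall p, M p -> j p = 2^-1 *: grad M (fun q => dot (c q) (c q)) p) ->
  radial_field M e ->
  normal_section M k ->
  (forall X, tangent_field M X -> forall p, M p ->
     norpart M p (Dd M (fun q => e q - k q) p (X p)) = 0) ->
  diffeomorphism M M1 F1 G1 ->
  diffeomorphism M M2 F2 G2 ->
  metric_section M1 c1 ->
  metric_section M2 c2 ->
  radial_field M1 e1 ->
  radial_field M2 e2 ->
  [/\ flat_semiumbilical_surface M1 /\ flat_semiumbilical_surface M2,
      exists2 u, parallel_section M u & forall p, M p -> f21 p = f p + u p,
      exists2 u, parallel_section M u & forall p, M p -> f12 p = f p + u p,
      radial_field M1 e1' &
      forall p, M p -> (transf t2 c1 e1' \o F1) p = f p].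
Proof.
move=> [surfM flatM _] mc jE re nk ek d1 d2 mc1 mc2 re1 re2.
(* Stated for arbitrary parameters so that both orders of composition are instances; they then agree
   up to commuting the products of coefficients. *)
have step (t t' : R) (G c' e' : 'rV[R]_4 -> 'rV[R]_4) :
    diffeomorphism M (transf t c e @` M) (transf t c e) G ->
    metric_section (transf t c e @` M) c' -> radial_field (transf t c e @` M) e' ->
    exists2 u, parallel_section M u & forall p, M p ->
      transf t' c' e' (transf t c e p) = p + (t * t') *: (c p - j p)
        - ((1 - t) * (1 - t')) *: (e p - k p) + u p.
  move=> d mc' re'.
  (* The second map carries its radial field with weight [- (1 - t')], so replacing the
     distinguished field by [e'] changes the result by exactly this section. *)
  exists (fun p => (1 - t') *: (transf_radial c k t p - e' (transf t c e p))).
    exact: (parallel_transf surfM mc re nk ek d _ re').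
  move=> p Mp; rewrite -(transf_transf k surfM flatM mc re d t' mc' Mp (jE p Mp)).
  rewrite [in RHS]/transf /= (transf_GF d Mp) [in LHS]/transf.
  move: (transf t c e p) => q.
  by apply/rowP => i; rewrite !mxE; ring.
have [u1 pu1 u1E] := step t1 t2 G1 c1 e1 d1 mc1 re1.
have [u2 pu2 u2E] := step t2 t1 G2 c2 e2 d2 mc2 re2.
split.
- split; first exact: (flat_semiumbilical_transf surfM mc re d1 mc1).
  exact: (flat_semiumbilical_transf surfM mc re d2 mc2).
- by exists u1.
- exists u2 => // p Mp; rewrite /f12 /= (u2E p Mp) /f.
  by rewrite (mulrC t2) (mulrC (1 - t2)).
- exact: (radial_field_transf surfM mc re nk ek d1).
- by move=> p Mp; exact: (transf_transf k surfM flatM mc re d1 t2 mc1 Mp (jE p Mp)).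
Qed.
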